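(* Let $d\ge 2$ and $\rho<\frac{R}{6d}$. With access to an inner product oracle with permissible queries $\mathcal{Q}^{dir}$, we have $$\operatorname{icomp}(\mathcal{I}_{n,d,R,\rho},\mathcal{Q}^{dir})=\Omega\left(2^n d^2\left(1+\frac{1}{\log d}\log\left(\frac{R}{\rho}\right)\right)\right).$$ In fact, this holds even if the query returns the entire inner product of the desired direction and the normal vector of the separating hyperplane: under the same conditions, $$\operatorname{icomp}(\mathcal{I}_{n,d,R,\rho},\mathcal{Q}^{ip})=\Omega\left(2^n d^2\left(1+\frac{1}{\log d}\log\left(\frac{R}{\rho}\right)\right)\right).$$
   Context: Throughout, $n\ge 0$ and $d\ge 1$ are integers (numbers of integer and continuous variables), $R,\rho>0$ are reals, and $\Omega$ hides a universal positive constant. **Instances.** $\mathcal{I}_{n,d,R,\rho}$ is the family of all closed convex sets $C\subseteq\mathbb{R}^n\times\mathbb{R}^d$ such that $C\subseteq[-R,R]^{n+d}$ and, if $C$ is feasible (i.e. $C\cap(\mathbb{Z}^n\times\mathbb{R}^d)\neq\emptyset$), then there exists $(x^\star,y^\star)\in\mathbb{Z}^n\times\mathbb{R}^d$ with $\{(x^\star,y): y\in\mathbb{R}^d,\ \|y-y^\star\|_\infty\le\rho\}\subseteq C$. Infeasible sets (including $C=\emptyset$) are allowed. **Feasibility problem.** For an unknown instance $C\in\mathcal{I}_{n,d,R,\rho}$, report a point of $C\cap(\mathbb{Z}^n\times\mathbb{R}^d)$ if one exists, and otherwise report that the instance is infeasible. **First-order map.** A first-order map for $\mathcal{I}_{n,d,R,\rho}$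 is a function $\mathcal{G}:\mathcal{I}_{n,d,R,\rho}\times(\mathbb{R}^n\times\mathbb{R}^d)\to\mathbb{R}^n\times\mathbb{R}^d$ such that $\mathcal{G}(C,\hat z)=0$ if $\hat z\in C$; otherwise $\mathcal{G}(C,\hat z)$ is the (nonzero) normal vector of a separating hyperplane, satisfying $\langle\mathcal{G}(C,\hat z),z\rangle<\langle\mathcal{G}(C,\hat z),\hat z\rangle$ for all $z\in C$. **Oracle.** Given a set $\mathcal{Q}$ of permissible queries (functions on $\mathbb{R}^n\times\mathbb{R}^d$) and a first-order map $\mathcal{G}$, the oracle $\mathcal{O}(\mathcal{Q},\mathcal{G})$ takes a point $z\in\mathbb{R}^n\times\mathbb{R}^d$ and a query $q\in\mathcal{Q}$, and returns for the instance $C$ the answer $q(\mathcal{G}(C,z))$. Without knowing the instance $C$, and based only on the oracle responses so far, the algorithm chooses in each step a pair $(z,q)$ and receives the answer. **Information complexity.** $\operatorname{icomp}(\mathcal{I}_{n,d,R,\rho},\mathcal{Q})$ is the minimum natural number $k$ such that there exists an algorithm that solves the feasibility problem for $\mathcal{I}_{n,d,R,\rho}$ by making at most $k$ queries to the oracle $\mathcal{O}(\mathcal{Q},\mathcal{G})$, for any first-order map $\mathcal{G}$. **Query sets.** $\mathcal{Q}^{dir}$ (inner product oracle) is the set of queries $q_v$, $v\in\mathbb{R}^n\times\mathbb{R}^d$, with $q_v(g)=1$ if $\langle v,g\rangle>0$ and $q_v(g)=0$ otherwise. $\mathcal{Q}^{ip}$ is the set of queries $g\mapsto\langle v,g\rangle$,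 $v\in\mathbb{R}^n\times\mathbb{R}^d$, which return the entire inner product.
   Formalization: The formal theorem additionally assumes R ≥ 1 whenever n ≥ 1; for R < 1 the only integer point of [-R,R]^n is 0, so the information complexity with full inner products grows at most linearly in n and the factor 2^n fails. *)

(* Defs.v *)
From HB Require Import structures.
From mathcomp Require Import all_boot all_order all_algebra.
From mathcomp Require Import all_classical all_reals all_analysis.
Set Implicit Arguments.
Unset Strict Implicit.
Unset Printing Implicit Defensive.
Import Order.TTheory GRing.Theory Num.Theory.
Import numFieldNormedType.Exports.
Local Open Scope classical_set_scope.
Local Open Scope ring_scope.

Notation point K n d := ('rV[K]_n * 'rV[K]_d)%type.

Definition inner (K : realType) (n d : nat) (u v : point K n d) : K :=
  \sum_(i < n) u.1 0 i * v.1 0 i + \sum_(j < d) u.2 0 j * v.2 0 j.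

Definition mixed_integer (K : realType) (n d : nat) : set (point K n d) :=
  [set z : point K n d | forall i, z.1 0 i \is a Num.int].

Definition feasible (K : realType) (n d : nat) (C : set (point K n d)) : Prop :=
  C `&` @mixed_integer K n d !=set0.

(* The norm on ['rV[K]_d] is the sup norm, so [`|y - z.2| <= rho] is a
   cube of radius [rho] in the fiber over [z.1]. *)
Definition instances (K : realType) (n d : nat) (R rho : K) :
    set (set (point K n d)) :=
  [set C : set (point K n d) | [/\ closed C,
    convex_set C,
    forall z : point K n d, C z -> (forall i, - R <= z.1 0 i <= R) /\
                     (forall j, - R <= z.2 0 j <= R)
    & feasible C ->
      exists2 z : point K n d, mixed_integer z &
        forall y : 'rV[K]_d, `|y - z.2| <= rho -> C (z.1, y)]].

(* [G] is total; its values at sets outside [I] are irrelevant.  The condition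
   [G C z != 0] is not redundant: for [C = set0] the inequality is vacuous. *)
Definition first_order_map (K : realType) (n d : nat)
    (I : set (set (point K n d)))
    (G : set (point K n d) -> point K n d -> point K n d) : Prop :=
  forall C, I C -> forall z : point K n d,
    (C z -> G C z = 0) /\
    (~ C z -> G C z != 0 /\
              forall w, C w -> inner (G C z) w < inner (G C z) z).

Definition query (K : realType) (n d : nat) (A : Type) : Type :=
  point K n d -> A.

Definition Qdir (K : realType) (n d : nat) : set (query K n d bool) :=
  [set q | exists v : point K n d, q = (fun g => 0 < inner v g)].

Definition Qip (K : realType) (n d : nat) : set (query K n d K) :=
  [set q | exists v : point K n d, q = (fun g => inner v g)].

(* A deterministic adaptive algorithm, as a decision tree branching on the
   answers received.  [Report None] declares the instance infeasible. *)
Inductive algorithm (K : realType) (n d : nat) (A : Type) : Type :=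
| Report of option (point K n d)
| Ask of point K n d & query K n d A & (A -> algorithm K n d A).

Arguments Report {K n d A} _.
Arguments Ask {K n d A} _ _ _.

Fixpoint permissible (K : realType) (n d : nat) (A : Type)
    (Q : set (query K n d A)) (alg : algorithm K n d A) : Prop :=
  match alg with
  | Report _ => True
  | Ask _ q next => Q q /\ forall a, permissible Q (next a)
  end.

(* [g] is the map [G C] of the unknown instance; it is only accessed through
   the answers [q (g z)]. *)
Fixpoint output (K : realType) (n d : nat) (A : Type)
    (g : point K n d -> point K n d) (alg : algorithm K n d A) :
    option (point K n d) :=
  match alg with
  | Report r => r
  | Ask z q next => output g (next (q (g z)))
  end.

Fixpoint num_queries (K : realType) (n d : nat) (A : Type)
    (g : point K n d -> point K n d) (alg : algorithm K n d A) : nat :=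
  match alg with
  | Report _ => 0
  | Ask z q next => (num_queries g (next (q (g z)))).+1
  end.

Definition correct_report (K : realType) (n d : nat) (C : set (point K n d))
    (r : option (point K n d)) : Prop :=
  match r with
  | Some z => C z /\ mixed_integer z
  | None => ~ feasible C
  end.

Definition solves_within (K : realType) (n d : nat) (A : Type)
    (I : set (set (point K n d))) (Q : set (query K n d A))
    (k : nat) (alg : algorithm K n d A) : Prop :=
  permissible Q alg /\
  forall G, first_order_map I G -> forall C, I C ->
    correct_report C (output (G C) alg) /\
    (num_queries (G C) alg <= k)%N.

(* The infimum of a set of natural numbers: its minimum, or [+oo] when no
   algorithm with a uniformly bounded number of queries exists. *)
Definition icomp (K : realType) (n d : nat) (A : Type)
    (I : set (set (point K n d))) (Q : set (query K n d A)) : \bar K :=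
  ereal_inf [set (k%:R)%:E | k in
    [set k : nat | exists alg, solves_within I Q k alg]].

(* Main.v *)
Require Import Defs.
From HB Require Import structures.
From mathcomp Require Import all_boot all_order all_algebra.
From mathcomp Require Import all_classical all_reals all_analysis.
From mathcomp Require Import ring lra zify.
Set Implicit Arguments.
Unset Strict Implicit.
Unset Printing Implicit Defensive.
Import Order.TTheory GRing.Theory Num.Theory.
Import numFieldNormedType.Exports.
Local Open Scope classical_set_scope.
Local Open Scope ring_scope.

(** The proof is an adversary argument.  After each question the adversary
    commits itself to as little as possible about the normals, and as long as
    fewer than [2 ^ n * M] questions have been asked, both a feasible and an
    infeasible instance agree with all its answers; no report is then correct
    for both.

    _The continuous game_ ([survives_all_rounds]) is the case of one fiber.  A
    separating hyperplane at [y] is asked for through inner products of its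
    normal [u] with chosen vectors.  To the first [k], about [d / 4], vectors
    asked at [y] the adversary replies 0, which only confines [u] to a subspace
    of dimension at least [d - k]; at the next one it has to commit to [u].
    A round lasts [k ^ 2] questions and shrinks the cube in which the instance
    may still lie from radius [r] to radius [r / (6 * d)].  The center of the new
    cube is sought among the [2 ^ d] points [c + (r / 2) * s - t * v], with [s] a
    vector of signs.
    - Fewer than [k] points get a committed normal in a round.  These normals are
      chosen orthonormal; each has the sign that keeps at least half of the
      remaining [s] on its good side, and [v] is their sum, so that the shift by
      [- t * v] turns weak inequalities into strict ones with room for the cube.
      The shift is small because [v] has Euclidean norm at most [sqrt k].
    - At most [k ^ 2] points are left with only a subspace of possible normals.
      Each of them rules out at most [2 ^ k] vectors of signs ([few_inseparable]):
      by [bounded_pivots], if two vectors of signs agree on [k] suitable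
      coordinates and differ at a coordinate [j], then one of them is separated
      from [y] by a normal that vanishes off these [k + 1] coordinates and has
      [l1norm] at most [k + 1].
    As [k ^ 2 * 2 ^ k] is less than [2 ^ d / 2 ^ (k - 1)], some [s] remains.

    _The mixed-integer game_ ([query_lower_bound]) plays one continuous game in
    the fiber of each vertex of [[0, 1]^n].  A normal at a point of the fiber of
    the vertex [x] is [(2 x - 1, a u)]: its first component exposes [x] among all
    points of the cube, and [u] is the normal of the continuous game.  The factor
    [a] is chosen when [u] is, so small that neither the other fibers nor any of
    the points accepted so far are cut off.  A point outside the fibers is
    accepted, that is, declared to belong to the instance, unless it lies outside
    the bounding box or an earlier normal excludes it; since a vertex is an
    extreme point of the cube, accepting such points adds nothing to the fibers.
    At the end the infeasible instance is the convex hull of the accepted points,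
    and the feasible one also contains the cube that survives in one fiber; some
    fiber has been asked at most [M] questions.

    Points at which nothing was asked get normals from the separation theorem for
    compact convex sets ([separation]).  Finally [M] is [k ^ 2] times the number
    of rounds, the integral part of [ln (R / rho) / ln (6 * d)]
    ([number_of_rounds]). *)

(** * Orthogonal vectors with bounded coordinates *)

Section DotProduct.
Context {K : realType} {d : nat}.
Implicit Types (u v w c : 'rV[K]_d) (B : seq 'rV[K]_d) (a : K).

Definition dot u v : K := \sum_j u 0 j * v 0 j.

Definition l1norm u : K := \sum_j `|u 0 j|.

Lemma dotC u v : dot u v = dot v u.
Proof. by apply: eq_bigr => j _; rewrite mulrC. Qed.

Lemma dotDr u v w : dot u (v + w) = dot u v + dot u w.
Proof. by rewrite -big_split; apply: eq_bigr => j _; rewrite mxE mulrDr. Qed.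

Lemma dotZr a u v : dot u (a *: v) = a * dot u v.
Proof. by rewrite mulr_sumr; apply: eq_bigr => j _; rewrite mxE mulrCA. Qed.

Lemma dotNr u v : dot u (- v) = - dot u v.
Proof. by rewrite -scaleN1r dotZr mulN1r. Qed.

Lemma dotBr u v w : dot u (v - w) = dot u v - dot u w.
Proof. by rewrite dotDr dotNr. Qed.

Lemma dot0r u : dot u 0 = 0.
Proof. by rewrite -(scale0r 0) dotZr mul0r. Qed.

Lemma dotZl a u v : dot (a *: v) u = a * dot v u.
Proof. by rewrite dotC dotZr dotC. Qed.

Lemma dotNl u v : dot (- v) u = - dot v u.
Proof. by rewrite dotC dotNr dotC. Qed.

Lemma dot0l u : dot 0 u = 0.
Proof. by rewrite dotC dot0r. Qed.

Lemma dot_sumr (I : Type) (s : seq I) (F : I -> 'rV[K]_d) u :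
  dot u (\sum_(i <- s) F i) = \sum_(i <- s) dot u (F i).
Proof.
elim: s => [|i s IHs]; first by rewrite !big_nil dot0r.
by rewrite !big_cons dotDr IHs.
Qed.

Lemma l1norm_ge0 u : 0 <= l1norm u.
Proof. exact: sumr_ge0. Qed.

Lemma l1normN u : l1norm (- u) = l1norm u.
Proof. by apply: eq_bigr => j _; rewrite mxE normrN. Qed.

Lemma l1normZ a u : l1norm (a *: u) = `|a| * l1norm u.
Proof. by rewrite mulr_sumr; apply: eq_bigr => j _; rewrite mxE normrM. Qed.

Lemma dot_le_l1norm u w r : (forall j, `|w 0 j| <= r) -> `|dot u w| <= r * l1norm u.
Proof.
move=> wr; apply: le_trans (ler_norm_sum _ _ _) _.
rewrite mulr_sumr; apply: ler_sum => j _; rewrite normrM mulrC.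
exact: ler_wpM2r.
Qed.

Lemma dot_self_ge0 u : 0 <= dot u u.
Proof. by apply: sumr_ge0 => j _; rewrite -expr2 sqr_ge0. Qed.

Lemma dot_self_gt0 u j : u 0 j != 0 -> 0 < dot u u.
Proof.
move=> uj0; rewrite /dot (bigD1 j) //= ltr_wpDr //.
  by apply: sumr_ge0 => i _; rewrite -expr2 sqr_ge0.
by rewrite -expr2 exprn_even_gt0.
Qed.

Lemma sqr_coord_le_dot u j : u 0 j ^+ 2 <= dot u u.
Proof.
rewrite /dot (bigD1 j) //= -expr2 lerDl.
by apply: sumr_ge0 => i _; rewrite -expr2 sqr_ge0.
Qed.

(** This is Cauchy-Schwarz, from [0 <= sum_j (t - |u_j|)^2] with [t] the mean of
    the [|u_j|]. *)
Lemma sqr_l1norm_le u : l1norm u ^+ 2 <= d%:R * dot u u.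
Proof.
case: (posnP d) => [d0|d_gt0].
  rewrite /l1norm big1 ?expr0n ?d0 ?mul0r // => j.
  by have := ltn_ord j; rewrite {2}d0.
have dK : 0 < d%:R :> K by rewrite ltr0n.
pose t := l1norm u / d%:R.
have: 0 <= \sum_j (t - `|u 0 j|) ^+ 2 by apply: sumr_ge0 => j _; rewrite sqr_ge0.
have -> : \sum_j (t - `|u 0 j|) ^+ 2 =
    d%:R * t ^+ 2 - 2 * t * l1norm u + dot u u.
  rewrite mulr_sumr -sumrN -[X in X * _ ^+ _](_ : \sum_(j < d) 1 = _).
    rewrite mulr_suml -!big_split; apply: eq_bigr => j _ /=.
    by rewrite -[u 0 j * _]expr2 -(real_normK (num_real (u 0 j))); ring.
  by rewrite sumr_const card_ord.
rewrite /t => H; have -> : l1norm u ^+ 2 =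
   d%:R * dot u u - d%:R * (d%:R * (l1norm u / d%:R) ^+ 2
     - 2 * (l1norm u / d%:R) * l1norm u + dot u u).
  by field; rewrite gt_eqF.
by rewrite gerBl mulr_ge0 // ltW.
Qed.

(** Among the maximal minors of a row basis of [B], one of largest absolute
    value is indexed by [P].  By Cramer's rule the coordinates of any other
    column on the columns in [P] are quotients of minors by that one, hence
    bounded by 1, and give the vector [u].  Any bound of the order of [d / size B]
    would do in [round_end], but pivoting one column at a time may lose an
    exponential factor. *)
Lemma bounded_pivots B : exists2 P : {set 'I_d}, (#|P| <= size B)%N &
  forall j, j \notin P -> exists u, [/\ u 0 j = 1,
    forall l, l \notin P -> l != j -> u 0 l = 0,
    forall l, `|u 0 l| <= 1 & forall b, b \in B -> dot b u = 0].
Proof.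
pose M := \matrix_(i < size B) (nth 0 B i).
set r := \rank M; pose D : 'M[K]_(d, r) := (row_base M)^T.
have Dfull : row_full D by rewrite /row_full mxrank_tr; apply: row_base_free.
pose minor (f : {ffun 'I_r -> 'I_d}) := rowsub f D.
pose f0 : {ffun 'I_r -> 'I_d} := [ffun i => fullrankfun Dfull i].
have f0_unit : minor f0 \in unitmx.
  rewrite /minor (_ : rowsub f0 D = rowsub (fullrankfun Dfull) D).
    exact: fullrowsub_unit.
  by apply/matrixP => i l; rewrite !mxE ffunE.
have [f _ f_max] := @arg_maxP _ _ _ f0 xpredT (fun f => `|\det (minor f)|) isT.
have detf_gt0 : 0 < `|\det (minor f)|.
  by apply: lt_le_trans (f_max f0 isT); rewrite normr_gt0 -unitfE -unitmxE.
have f_unit : minor f \in unitmx by rewrite unitmxE unitfE -normr_gt0.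
exists (f @: [set: 'I_r])%SET.
  apply: leq_trans (leq_imset_card _ _) _.
  by rewrite cardsT card_ord rank_leq_row.
move=> j jP; pose a := row j D *m invmx (minor f).
have f_inj : injective f.
  move=> i1 i2 ei; apply: contraTeq f_unit => ne12.
  rewrite unitmxE unitfE negbK; apply/eqP.
  by apply: (determinant_alternate ne12) => l; rewrite !mxE ei.
have a_le1 i : `|a 0 i| <= 1.
  pose f' := [ffun l => if l == i then j else f l].
  suff -> : a 0 i = \det (minor f') / \det (minor f).
    by rewrite normrM normfV ler_pdivrMr // mul1r; exact: f_max.
  rewrite /a /invmx f_unit -scalemxAr mxE [LHS]mulrC; congr (_ * _).
  rewrite (expand_det_row _ i) mxE; apply: eq_bigr => l _.
  rewrite !mxE ffunE eqxx; congr (_ * (_ * \det _)).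
  apply/matrixP => x y; rewrite !mxE ffunE ifF //.
  by apply/negbTE; rewrite eq_sym neq_lift.
have [u [uj uf u0]] : exists u : 'rV[K]_d, [/\ u 0 j = 1,
    forall i, u 0 (f i) = - a 0 i &
    forall l, l \notin (f @: [set: 'I_r])%SET -> l != j -> u 0 l = 0].
  exists (\row_l (if l == j then 1 else - \sum_(i < r | f i == l) a 0 i)).
  split=> [|i|l lP lj]; rewrite mxE ?eqxx //.
    rewrite ifF; last by apply: contraNF jP => /eqP <-; apply: imset_f.
    congr (- _); rewrite (big_pred1 i) // => i' /=.
    by apply/eqP/eqP => [/f_inj|->].
  rewrite (negPf lj) big_pred0 ?oppr0 // => i.
  by apply: contraNF lP => /eqP <-; apply: imset_f.
exists u; split => // [l|b bB].
  case: (boolP (l \in (f @: [set: 'I_r])%SET)) => [/imsetP[i _ ->]|lP].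
    by rewrite uf normrN.
  by have [->|lj] := eqVneq l j; rewrite ?uj ?normr1 // u0 // normr0.
have uD : u *m D = 0.
  have -> : u *m D = row j D - a *m minor f.
    apply/rowP => x; rewrite mxE (bigID (mem (f @: [set: 'I_r])%SET)) /= addrC.
    rewrite [RHS]mxE; congr (_ + _).
      rewrite (bigD1 j) //= big1 ?addr0 ?uj ?mul1r; first by rewrite [RHS]mxE.
      by move=> l /andP[lP lj]; rewrite u0 ?mul0r.
    rewrite big_imset /=; last by move=> ? ? _ _; apply: f_inj.
    rewrite !mxE -sumrN; apply: eq_big => [i|i _]; first by rewrite inE.
    by rewrite uf !mxE mulNr.
  by rewrite /a mulmxKV // subrr.
have /submxP[y by_] : (b <= row_base M)%MS.
  rewrite eq_row_base.
  have -> : b = row (Ordinal (etrans (index_mem b B) bB)) M.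
    by apply/rowP => x; rewrite !mxE /= nth_index.
  exact: row_sub.
have -> : dot b u = (u *m b^T) 0 0.
  by rewrite mxE; apply: eq_bigr => l _; rewrite !mxE mulrC.
by rewrite by_ trmx_mul mulmxA uD mul0mx mxE.
Qed.

(** Fewer than [d] vectors have a common orthogonal vector, of norm 1 after
    scaling. *)
Lemma unit_orthogonal B : (size B < d)%N ->
  exists2 g, dot g g = 1 & forall b, b \in B -> dot b g = 0.
Proof.
move=> Bd; have [P leP piv] := bounded_pivots B.
have [j jP] : exists j, j \notin P.
  apply/existsP; rewrite -negb_forall; apply: contraTN (leq_ltn_trans leP Bd).
  move=> /forallP PT; rewrite -leqNgt -[d in leqLHS]card_ord.
  by apply/subset_leq_card/fintype.subsetP => j _; apply: PT.
have [u [uj1 _ _ uB]] := piv _ jP.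
have uu : 0 < dot u u by apply: (dot_self_gt0 (j := j)); rewrite uj1 oner_eq0.
exists ((Num.sqrt (dot u u))^-1 *: u) => [|b bB]; last by rewrite dotZr (uB b) ?mulr0.
rewrite dotZl dotZr mulrA -invfM -expr2 sqr_sqrtr ?ltW // mulVf //.
by rewrite gt_eqF.
Qed.

End DotProduct.

(** * Separating a point from a small cube *)

(** What the adversary has committed itself to at a point: with [Open B], that
    the normal (its last [d] coordinates, in the mixed-integer game) is orthogonal
    to [B]; with [Fixed g], that it is [g].  [Open [::]] is kept for the points at
    which nothing has been asked yet. *)
Inductive status (K : realType) (d : nat) (T : Type) : Type :=
| Open of seq 'rV[K]_d
| Fixed of T.
Arguments Open {K d T} _.
Arguments Fixed {K d T} _.

Definition update (X : eqType) (Y : Type) (f : X -> Y) (x : X) (y : Y) : X -> Y :=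
  fun x' => if x' == x then y else f x'.

Section Cubes.
Context {K : realType} {d : nat}.
Implicit Types (u c y g : 'rV[K]_d) (B G : seq 'rV[K]_d) (r : K).

Definition orth B u := forall b, b \in B -> dot b u = 0.

(** The hyperplane through [y] with normal [u] has the cube of center [c] and radius
    [r] strictly on its lower side: the left-hand side is the maximum of [dot u]
    over the cube. *)
Definition below c r u y := dot u c + r * l1norm u < dot u y.

Lemma below_scale c r u y a : 0 < a -> below c r u y -> below c r (a *: u) y.
Proof.
move=> a0; rewrite /below !dotZl l1normZ gtr0_norm // mulrCA -mulrDr.
by rewrite ltr_pM2l.
Qed.

Lemma below_subcube c r c' r' u y :
  (forall j, `|c' 0 j - c 0 j| + r' <= r) -> below c r u y -> below c' r' u y.
Proof.
move=> sub; apply: le_lt_trans.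
have H : dot u (c' - c) <= (r - r') * l1norm u.
  apply: le_trans (ler_norm _) (dot_le_l1norm _ _) => j.
  by rewrite !mxE lerBrDr.
by rewrite dotBr in H; lra.
Qed.

Definition sign_vector (s : {ffun 'I_d -> bool}) : 'rV[K]_d :=
  \row_j (-1) ^+ s j.

(** If [s] and [t] agree on the pivots of [B] but not at [j], the vector [u] given
    by [bounded_pivots] for [j] takes values at the two candidate centers that are
    [2 * a] apart, whereas a center at which both [u] and [- u] fail to separate
    [y] from the cube has its value within [r * l1norm u] of [dot u y].  Hence
    inseparable candidates are determined by their signs on the pivots. *)
Lemma few_inseparable B y p a r : 0 <= r -> r * (size B).+1%:R < a ->
  exists2 bad : {set {ffun 'I_d -> bool}}, (#|bad| <= 2 ^ size B)%N &
    forall s, s \notin bad ->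
      exists2 u, orth B u & below (p + a *: sign_vector s) r u y.
Proof.
move=> r0 ra.
pose sep s := exists2 u, orth B u & below (p + a *: sign_vector s) r u y.
have [P PB piv] := bounded_pivots B.
pose bad := [set s | ~~ `[< sep s >]]%SET.
exists bad => [|s]; last by rewrite inE negbK => /asboolP.
apply: (@leq_trans #|powerset P|); last by rewrite card_powerset leq_exp2l.
pose h (s : {ffun 'I_d -> bool}) := [set j in P | s j]%SET.
have h_inj : {in bad &, injective h}.
  move=> s t; rewrite !inE => /asboolP sbad /asboolP tbad hst.
  apply/ffunP => j; apply/eqP; apply: contrapT => /negP st_j.
  have eqP l : l \in P -> s l = t l.
    by move=> lP; move/setP: hst => /(_ l); rewrite !inE lP.
  have jP : j \notin P by apply: contraNN st_j => /eqP ->.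
  have [u [uj u0 u1 uB]] := piv _ jP.
  have uP : l1norm u <= (size B).+1%:R.
    rewrite /l1norm (bigD1 j) //= uj normr1 (bigID (mem P)) /= [X in _ + (_ + X)]big1.
      rewrite addr0 -[X in _ <= X]natr1 addrC lerD2r.
      apply: le_trans (_ : \sum_(i in P) 1 <= _); last by rewrite sumr_const ler_nat.
      apply: (@le_trans _ _ (\sum_(i | (i != j) && (i \in P)) 1)).
        by apply: ler_sum => l _; apply: u1.
      rewrite [leRHS](bigID (fun i => i != j)) /=.
      rewrite [X in _ <= X + _](eq_bigl (fun i => (i != j) && (i \in P))).
        by rewrite lerDl sumr_ge0.
      by move=> i; rewrite andbC.
    by move=> l /andP[lj lP]; rewrite u0 // normr0.
  have near x : ~ sep x ->
      `|dot u y - dot u (p + a *: sign_vector x)| <= r * l1norm u.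
    move=> nsep; rewrite ler_norml; apply/andP; split; rewrite leNgt;
      apply/negP => H; apply: nsep.
      exists (- u); first by move=> b /uB; rewrite dotNr => ->; rewrite oppr0.
      by rewrite /below !dotNl l1normN; lra.
    by exists u => //; rewrite /below; lra.
  have dot_diff : dot u (sign_vector s) - dot u (sign_vector t) =
      (-1) ^+ s j - (-1) ^+ t j.
    rewrite -dotBr /dot (bigD1 j) //= big1 ?addr0 ?uj ?mul1r ?mxE //.
    move=> l lj; case: (boolP (l \in P)) => [/eqP el|lP]; last by rewrite u0 ?mul0r.
    by rewrite !mxE el subrr mulr0.
  have two : `|dot u (sign_vector s) - dot u (sign_vector t)| = 2.
    rewrite dot_diff; case: (s j) (t j) st_j => [] [] //= _.
      by rewrite expr1 expr0 -opprD normrN ger0_norm.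
    by rewrite expr1 expr0 opprK ger0_norm.
  have a_gt0 : 0 < a by apply: le_lt_trans ra; rewrite mulr_ge0.
  have : a * 2 <= r * l1norm u * 2.
    rewrite -[X in _ * X <= _]two -[X in X * `|_|](gtr0_norm a_gt0) -normrM.
    have -> : a * (dot u (sign_vector s) - dot u (sign_vector t)) =
      (dot u y - dot u (p + a *: sign_vector t)) -
      (dot u y - dot u (p + a *: sign_vector s)).
      by rewrite !dotDr !dotZr; ring.
    apply: le_trans (ler_normB _ _) _.
    by have := near _ sbad; have := near _ tbad; lra.
  by have := ler_wpM2l r0 uP; lra.
rewrite -(card_in_imset h_inj); apply/subset_leq_card/fintype.subsetP => _ /imsetP[s _ ->].
by rewrite powersetE; apply/fintype.subsetP => l; rewrite inE => /andP[].
Qed.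

Lemma uniform_choice (I : eqType) (S : {set {ffun 'I_d -> bool}}) (N : nat)
    (P : I -> {ffun 'I_d -> bool} -> Prop) (ys : seq I) :
  (forall i, i \in ys -> exists2 bad : {set {ffun 'I_d -> bool}},
      (#|bad| <= N)%N & forall s, s \notin bad -> P i s) ->
  (size ys * N < #|S|)%N ->
  exists2 s, s \in S & forall i, i \in ys -> P i s.
Proof.
elim: ys S => [|y ys IHys] S Pys /= Slarge.
  by have /card_gt0P[s sS] : (0 < #|S|)%N by []; exists s.
have [bad bad_small Py] := Pys y (mem_head _ _).
have [||s] := IHys (S :\: bad)%SET _ _.
- by move=> x xys; apply: Pys; rewrite inE xys orbT.
- rewrite -(ltn_add2l N) -mulSn; apply: leq_trans Slarge _.
  rewrite -(cardsID bad S) leq_add2r.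
  exact: leq_trans (subset_leq_card (subsetIr _ _)) bad_small.
rewrite inE => /andP[sbad sS] Ps; exists s => // x.
by rewrite inE => /predU1P[->|/Ps//]; apply: Py.
Qed.

Fixpoint orthonormal (G : seq 'rV[K]_d) : Prop :=
  if G is g :: G' then [/\ dot g g = 1, orth G' g & orthonormal G'] else True.

Lemma dot_sum_orthonormal G g : orthonormal G -> g \in G ->
  dot g (\sum_(h <- G) h) = 1.
Proof.
elim: G => //= h G IHG [hh hG GG]; rewrite inE big_cons dotDr.
case/predU1P=> [->|gG].
  rewrite hh dot_sumr big_seq big1 ?addr0 // => b bG.
  by rewrite dotC hG.
by rewrite hG // add0r IHG.
Qed.

Lemma dot_orthonormal G g : orthonormal G -> g \in G -> dot g g = 1.
Proof.
elim: G => //= h G IHG [hh hG GG]; rewrite inE => /predU1P[->//|gG].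
exact: IHG.
Qed.

(** Coordinates of the sum are bounded through its Euclidean norm; the triangle
    inequality would give [size G], which is too large for the shift of the center
    in [round_end]. *)
Lemma norm_sum_orthonormal G j : orthonormal G ->
  `|(\sum_(h <- G) h) 0 j| <= Num.sqrt (size G)%:R.
Proof.
move=> Gon; set v := \sum_(h <- G) h.
have vv : dot v v = (size G)%:R.
  rewrite {1}/v dotC dot_sumr big_seq (eq_bigr (fun=> 1)).
    by rewrite -big_seq big_const_seq count_predT iter_addr_0.
  by move=> g gG; rewrite dotC dot_sum_orthonormal.
rewrite -sqrtr_sqr ler_wsqrtr // -vv; exact: sqr_coord_le_dot.
Qed.

Lemma l1norm_unit g : dot g g = 1 -> l1norm g <= Num.sqrt d%:R.
Proof.
move=> gg; rewrite -[leLHS]ger0_norm ?l1norm_ge0 // -sqrtr_sqr ler_wsqrtr //.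
by have := sqr_l1norm_le g; rewrite gg mulr1.
Qed.

End Cubes.

(** * The continuous game *)

(** Both the number of vectors that may be asked at a point before its normal is
    fixed and the bound on the number of normals fixed in a round; the value is
    the largest one for which [sqr_exp_lt] holds by a plain count of exponents. *)
Definition round_length (d : nat) : nat := (d + 2) %/ 4.

Section Rounds.
Context {K : realType} {d : nat} (R rho : K).
Hypotheses (d_ge2 : (2 <= d)%N) (R_gt0 : 0 < R) (rho_gt0 : 0 < rho).

Notation vec := 'rV[K]_d.
Notation position := (vec -> status K d vec).
Implicit Types (c u y : vec) (B G : seq vec) (r : K) (tau : position).

Definition separable c r (tau : position) := forall y,
  match tau y with
  | Open B => B = [::] \/ exists2 u, orth B u & below c r u y
  | Fixed u => below c r u y
  end.

Definition inside c r := forall j, `|c 0 j| + r <= R.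

(** The adversary can go on for [m] questions, keeping a cube of radius [rho]
    inside the box of radius [R] separated from every point asked about.  To a
    question [q] at [y] it replies 0 or commits itself to a normal.  It must cope
    with every positive multiple of this normal, because the multiple is dictated
    by the rest of the mixed-integer game. *)
Fixpoint survives (m : nat) (tau : position) : Prop :=
  (exists2 c, inside c rho & separable c rho tau) /\
  if m is m'.+1 then forall y q,
    if tau y is Open B then
      survives m' (update tau y (Open (q :: B))) \/
      exists2 u, orth B u &
        forall a, 0 < a -> survives m' (update tau y (Fixed (a *: u)))
    else True
  else True.

Notation k := (round_length d).

Let k_gt0 : (0 < k)%N. Proof. by rewrite divn_gt0 // addn2; lia. Qed.
Let k_le : (4 * k <= d + 2)%N. Proof. by rewrite mulnC leq_divM. Qed.

(** A normal fixed in the current round excludes no candidate center that is still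
    in [S]; the strict inequality with room for a cube is only reached at the end
    of the round, by a shift along [G]. *)
Definition spent_below c r G (S : {set {ffun 'I_d -> bool}}) u y :=
  exists a g, [/\ 0 < a, g \in G, u = a *: g &
    forall s, s \in S -> dot g (c + (r / 2) *: sign_vector s) <= dot g y].

Definition asked (x : status K d vec) : nat :=
  if x is Open B then size B else 0.

(** The position in a round that began with the cube of center [c] and radius [r]
    and has [q] questions to go.  [G] lists the normals fixed in the round, [S] the
    vectors of signs on the good side of all of them, and [ys] the points at which
    the round has asked questions without fixing the normal.  A point left open by
    an earlier round has a separating normal in reserve.  In [round_count] a fixed
    normal accounts for [k.+1] questions, hence [size G < k]. *)
Record round c r G (S : {set {ffun 'I_d -> bool}}) (ys : seq vec) (q : nat)
    (tau : position) : Prop := Round {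
  round_inside : inside c r;
  round_G : orthonormal G;
  round_S : (2 ^ d <= #|S| * 2 ^ size G)%N;
  round_fixed : forall y u, tau y = Fixed u ->
    below c r u y \/ spent_below c r G S u y;
  round_open : forall y B, tau y = Open B ->
    [\/ B = [::], exists2 u, orth B u & below c r u y
      | y \in ys /\ (size B <= k)%N];
  round_ys : forall y, y \in ys -> (0 < asked (tau y))%N;
  round_count : (size G * k.+1 + \sum_(y <- ys) asked (tau y) + q <= k ^ 2)%N }.

Lemma round_start c r tau : inside c r -> separable c r tau ->
  round c r [::] [set: {ffun 'I_d -> bool}]%SET [::] (k ^ 2) tau.
Proof.
move=> cr sep; split=> //.
- by rewrite muln1 cardsT card_ffun card_bool card_ord.
- by move=> y u Ey; left; have := sep y; rewrite Ey.
- move=> y B Ey; have := sep y; rewrite Ey => -[->|?]; first by apply: Or31.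
  exact: Or32.
- by rewrite big_nil.
Qed.

Lemma sqr_exp_lt : (k ^ 2 * 2 ^ k * 2 ^ k.-1 < 2 ^ d)%N.
Proof.
have kk : (k <= 2 ^ k.-1)%N by rewrite -{1}(prednK k_gt0) ltn_expl.
apply: (@leq_ltn_trans ((2 ^ k.-1) ^ 2 * 2 ^ k * 2 ^ k.-1)).
  by rewrite !leq_mul2r leq_exp2r // kk !orbT.
by rewrite -expnM -!expnD ltn_exp2l //; lia.
Qed.

(** The radii involved are [r / 2] for the signs, at most [r / 8] for the shift
    along [G], and [r / (6 * d) <= r / 12] for the new cube, which add up to less
    than [r].  The shift lowers each [dot g], for [g] in [G], by
    [r / (4 * sqrt d)], while [dot g] varies by at most
    [r / (6 * d) * sqrt d] over half the width of the new cube. *)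
Lemma round_end c r G S ys q tau : 0 < r -> round c r G S ys q tau ->
  exists c', inside c' (r / (6 * d%:R)) /\ separable c' (r / (6 * d%:R)) tau.
Proof.
move=> r_gt0 [cR Gon S_large fixedP openP ysP count].
have dK : 2 <= d%:R :> K by rewrite ler_nat.
set r' := r / (6 * d%:R).
have r'_gt0 : 0 < r' by rewrite divr_gt0 // mulr_gt0 //; lra.
have r'd : r' * (6 * d%:R) = r by rewrite /r' mulfVK //; lra.
have Gk : (size G <= k.-1)%N.
  have : (size G * k.+1 <= k ^ 2)%N by apply: leq_trans count; lia.
  by rewrite leqNgt => H; apply/negP => H2; move: H; nia.
set sd := Num.sqrt d%:R : K.
have sd_sqr : sd * sd = d%:R by rewrite -expr2 sqr_sqrtr.
have sd_gt0 : 0 < sd by rewrite sqrtr_gt0; lra.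
pose t := r / (4 * sd); have t_gt0 : 0 < t by rewrite divr_gt0 // mulr_gt0.
have t_sd : t * (4 * sd) = r by rewrite /t mulfVK // gt_eqF // mulr_gt0.
pose v := \sum_(h <- G) h.
have v_small j : `|v 0 j| <= sd / 2.
  apply: le_trans (norm_sum_orthonormal j Gon) _.
  rewrite -[leRHS]ger0_norm -?sqrtr_sqr; last by rewrite divr_ge0 // ltW.
  rewrite ler_wsqrtr // expr_div_n expr2 sd_sqr ler_pdivlMr // -natrX -natrM ler_nat.
  by move: Gk k_le k_gt0; lia.
pose ctr s := c - t *: v + (r / 2) *: sign_vector s.
have ctr_sub s j : `|ctr s 0 j - c 0 j| + r' <= r.
  rewrite !mxE addrAC [c 0 j - _]addrC addrK.
  have H1 : `|- (t * v 0 j)| <= r / 8.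
    rewrite normrN normrM gtr0_norm //.
    by have := ler_wpM2l (ltW t_gt0) (v_small j); lra.
  have H2 : `|r / 2 * (-1) ^+ s j| <= r / 2.
    by rewrite normrM normr_sign mulr1 ger0_norm // ltW // divr_gt0.
  have H3 : r' * 12 <= r.
    rewrite -r'd; apply: ler_wpM2l; [exact: ltW|lra].
  by have := ler_normD (- (t * v 0 j)) (r / 2 * (-1) ^+ s j); lra.
(* Even if every open point rules out [2 ^ k] vectors of signs, some remain. *)
have size_ys : (size ys * 2 ^ k < #|S|)%N.
  have ysk : (size ys <= k ^ 2)%N.
    apply: leq_trans count; apply: (@leq_trans (\sum_(y <- ys) asked (tau y))); last by lia.
    rewrite -sum1_size big_seq [leqRHS]big_seq.
    exact: leq_sum.
  have : (2 ^ d <= #|S| * 2 ^ k.-1)%N.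
    by apply: leq_trans S_large _; rewrite leq_mul2l leq_exp2l // Gk orbT.
  move=> /(leq_trans sqr_exp_lt); rewrite ltn_pmul2r ?expn_gt0 //.
  by apply: leq_ltn_trans; rewrite leq_mul2r ysk orbT.
pose sep y s := if tau y is Open B then
    (size B <= k)%N -> exists2 u, orth B u & below (ctr s) r' u y else True.
have [|s sS sepP] := uniform_choice (N := 2 ^ k) (P := sep) _ size_ys.
  move=> y _; rewrite /sep; case: (tau y) => [B|u]; last first.
    by exists finset.set0 => //; rewrite cards0.
  case: (leqP (size B) k) => [Bk|_]; last by exists finset.set0 => //; rewrite cards0.
  have [|bad badk Hb] := @few_inseparable _ _ B y (c - t *: v) (r / 2) r' (ltW r'_gt0).
    have Bd : (size B).+1%:R <= d%:R :> K by rewrite ler_nat; move: Bk k_le k_gt0; lia.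
    by have := ler_wpM2l (ltW r'_gt0) Bd; lra.
  exists bad; first by apply: leq_trans badk _; rewrite leq_exp2l.
  by move=> s sbad _; apply: Hb.
have shrink u y : below c r u y -> below (ctr s) r' u y.
  exact/below_subcube/ctr_sub.
exists (ctr s); split=> [j|y].
  have := ctr_sub s j; have := cR j; have := ler_normD (c 0 j) (ctr s 0 j - c 0 j).
  by rewrite [c 0 j + _]addrC subrK; lra.
case Ey: (tau y) => [B|u].
  have [->|[u uB uy]|[yys Bk]] := openP _ _ Ey; [by left|right|right].
    by exists u => //; apply: shrink.
  by have := sepP y yys; rewrite /sep Ey; apply.
have [/shrink //|[a [g [a_gt0 gG -> gS]]]] := fixedP _ _ Ey.
apply: below_scale => //; rewrite /below.
have : dot g (ctr s) <= dot g y - t.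
  have := gS s sS; rewrite /ctr !dotDr dotNr !dotZr dot_sum_orthonormal //; lra.
have := ler_wpM2l (ltW r'_gt0) (l1norm_unit (dot_orthonormal Gon gG)).
rewrite -/sd => H1 H2.
suff : r' * sd < t by lra.
rewrite -(ltr_pM2r sd_gt0) -mulrA sd_sqr; nra.
Qed.

Lemma asked_remove y x ys tau :
  let ys1 := [seq z <- ys | z != y] in
  (\sum_(z <- ys1) asked (update tau y x z) + (y \in ys) * asked (tau y)
     <= \sum_(z <- ys) asked (tau z))%N.
Proof.
rewrite /= big_filter [leqRHS](bigID (fun z => z != y)) /=.
rewrite (eq_bigr (fun z => asked (tau z))) => [|z /negPf zy]; last first.
  by rewrite /update zy.
rewrite leq_add2l; case: (boolP (y \in ys)) => // yys.
by rewrite mul1n (big_rem y yys) /= eqxx /= leq_addr.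
Qed.

Lemma half_split (S S1 S2 : {set {ffun 'I_d -> bool}}) :
  (#|S| <= #|S1| + #|S2|)%N -> (#|S| <= #|S1| * 2)%N \/ (#|S| <= #|S2| * 2)%N.
Proof. by move=> ?; case: (leqP #|S1| #|S2|) => ?; [right|left]; lia. Qed.

Lemma spent_below_sub c r g G (S S1 : {set {ffun 'I_d -> bool}}) u y :
  S1 \subset S -> spent_below c r G S u y -> spent_below c r (g :: G) S1 u y.
Proof.
move=> /fintype.subsetP S1S [a [h [a0 hG -> hS]]].
by exists a, h; split=> //; [rewrite inE hG orbT|move=> s /S1S/hS].
Qed.

(** The adversary prefers a normal held in reserve, if there is one; otherwise it
    replies 0 until [k] vectors have been asked at [y], and then fixes a normal
    orthogonal to these and to [G], with the sign that keeps half of [S]. *)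
Lemma round_step c r G S ys q tau y b B :
  round c r G S ys q.+1 tau -> tau y = Open B ->
  (exists ys', round c r G S ys' q (update tau y (Open (b :: B)))) \/
  exists2 u, orth B u & forall a, 0 < a -> exists G' S' ys',
    round c r G' S' ys' q (update tau y (Fixed (a *: u))).
Proof.
move=> [cR Gon S_large fixedP openP ysP count] Ey.
have ys1P x z : z \in [seq z <- ys | z != y] -> (0 < asked (update tau y x z))%N.
  by rewrite mem_filter /update => /andP[/negPf ->]; apply: ysP.
have openP1 x z C : (forall D, x <> Open D) -> update tau y x z = Open C ->
    [\/ C = [::], exists2 u, orth C u & below c r u z
      | z \in [seq z <- ys | z != y] /\ (size C <= k)%N].
  rewrite /update mem_filter; case: eqP => [_ /[apply] //|_ _ /=]; exact: openP.
case: (pselect (exists2 u, orth B u & below c r u y)) => [[u uB uy]|none].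
  right; exists u => // a a0; exists G, S, [seq z <- ys | z != y].
  split=> //.
  - move=> z w; rewrite /update; case: eqP => [-> [<-]|_]; last exact: fixedP.
    by left; apply: below_scale.
  - by move=> z C; apply: openP1.
  - exact: ys1P.
  - by have := asked_remove y (Fixed (a *: u)) ys tau; move: count => /=; lia.
have [Bk|kB] := ltnP (size B) k.
  left; exists (y :: [seq z <- ys | z != y]); split=> //.
  - by move=> z w; rewrite /update; case: eqP => // _; apply: fixedP.
  - move=> z C; rewrite /update inE mem_filter; case: eqP => [-> [<-]|_ /=].
      by apply: Or33.
    exact: openP.
  - move=> z; rewrite inE => /predU1P[->|/ys1P //]; by rewrite /update eqxx.
  - rewrite big_cons {1}/update eqxx /=.
    have := asked_remove y (Open (b :: B)) ys tau; rewrite Ey /=.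
    have : B = [::] \/ y \in ys.
      by case: (openP _ _ Ey) => [|//|[? _]]; [left|right].
    by move=> [->|->] /=; move: count; lia.
have [yys Bk] : y \in ys /\ size B = k.
  case: (openP _ _ Ey) => [B0|//|[? Bk]]; first by move: kB k_gt0; rewrite B0 /=; lia.
  by split=> //; apply/eqP; rewrite eqn_leq Bk.
have Gk : (size G < k)%N by rewrite ltnNge; apply/negP => H; move: count; nia.
have [|g gg gBG] := @unit_orthogonal _ _ (B ++ G).
  by rewrite size_cat Bk; move: k_le k_gt0; lia.
have gB : orth B g by move=> h hB; rewrite gBG // mem_cat hB.
have gG : orth G g by move=> h hG; rewrite gBG // mem_cat hG orbT.
have spend h (S1 : {set {ffun 'I_d -> bool}}) : dot h h = 1 -> orth G h ->
    S1 \subset S -> (#|S| <= #|S1| * 2)%N ->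
    (forall s, s \in S1 -> dot h (c + (r / 2) *: sign_vector s) <= dot h y) ->
    forall a, 0 < a -> exists G' S' ys',
      round c r G' S' ys' q (update tau y (Fixed (a *: h))).
  move=> hh hG S1S S1_large hS a a0.
  exists (h :: G), S1, [seq z <- ys | z != y]; split=> //.
  - by rewrite /= expnS mulnA (leq_trans S_large) // leq_mul2r S1_large orbT.
  - move=> z w; rewrite /update; case: eqP => [-> [<-]|_ /fixedP[]]; [right| |].
    + by exists a, h; split=> //; rewrite mem_head.
    + by left.
    + by right; apply: spent_below_sub S1S _.
  - by move=> z C; apply: openP1.
  - exact: ys1P.
  - have := asked_remove y (Fixed (a *: h)) ys tau.
    by rewrite yys Ey /= Bk mul1n mulSn; move: count; lia.
pose S1 h := [set s in S | dot h (c + (r / 2) *: sign_vector s) <= dot h y]%SET.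
have S1S h : S1 h \subset S by apply/fintype.subsetP => s; rewrite inE => /andP[].
right; case: (@half_split S (S1 g) (S1 (- g))) => [|H|H].
- rewrite -cardsUI; apply: leq_trans (leq_addr _ _).
  apply/subset_leq_card/fintype.subsetP => s sS; rewrite !inE sS !dotNl lerN2 /=.
  exact: le_total.
- exists g => //; apply: spend H _ => // s; by rewrite inE => /andP[].
- exists (- g); first by move=> h /gB; rewrite dotNr => ->; rewrite oppr0.
  apply: spend H _ => //; first by rewrite dotNl dotNr opprK.
    by move=> h /gG; rewrite dotNr => ->; rewrite oppr0.
  by move=> s; rewrite inE => /andP[].
Qed.

Lemma separable_radius c r r1 tau : r1 <= r -> separable c r tau -> separable c r1 tau.
Proof.
move=> r1r sep y; have sub j : `|c 0 j - c 0 j| + r1 <= r by rewrite subrr normr0 add0r.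
have := sep y; case: (tau y) => [B [->|[u uB uy]]|u]; first by left.
  by right; exists u => //; apply: below_subcube sub uy.
exact: below_subcube.
Qed.

Let d6_gt0 : 0 < 6 * d%:R :> K. Proof. by rewrite mulr_gt0 // ltr0n ltnW. Qed.

Let d6_ge1 : 1 <= 6 * d%:R :> K.
Proof. by have : 2 <= d%:R :> K; [rewrite ler_nat|lra]. Qed.

Lemma round_next t c r G S ys q tau :
  rho * (6 * d%:R) ^+ t.+1 <= r -> round c r G S ys q tau ->
  exists c' r', [/\ rho * (6 * d%:R) ^+ t <= r', inside c' r' & separable c' r' tau].
Proof.
move=> tr rnd; have r_gt0 : 0 < r by apply: lt_le_trans tr; rewrite mulr_gt0 // exprn_gt0.
have [c' [c'R c'sep]] := round_end r_gt0 rnd.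
by exists c', (r / (6 * d%:R)); split=> //; rewrite ler_pdivlMr // -mulrA -exprSr.
Qed.

Lemma round_alive t c r G S ys q tau :
  rho * (6 * d%:R) ^+ t.+1 <= r -> round c r G S ys q tau ->
  exists2 c', inside c' rho & separable c' rho tau.
Proof.
move=> tr rnd; have [c' [r' [tr' c'R c'sep]]] := round_next tr rnd.
have rho_le : rho <= r' by rewrite (le_trans _ tr') // ler_peMr ?exprn_ege1 // ltW.
exists c' => [j|]; last exact: separable_radius rho_le c'sep.
by apply: le_trans (c'R j); rewrite lerD2l.
Qed.

Lemma round_survives m t c r G S ys q tau :
  m = (t * k ^ 2 + q)%N -> rho * (6 * d%:R) ^+ t.+1 <= r ->
  round c r G S ys q tau -> survives m tau.
Proof.
elim: m t c r G S ys q tau => [|m IHm] t c r G S ys q tau m_eq tr rnd.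
  by split=> //; apply: round_alive tr rnd.
split=> [|y b]; first exact: round_alive tr rnd.
have [t1 [c1 [r1 [G1 [S1 [ys1 [q1 [m_eq1 tr1 rnd1]]]]]]]] :
    exists t c r G S ys q, [/\ m = (t * k ^ 2 + q)%N,
      rho * (6 * d%:R) ^+ t.+1 <= r & round c r G S ys q.+1 tau].
  (* When the round is over, the next one starts from the cube it leaves. *)
  case: q m_eq rnd => [|q] m_eq rnd; last first.
    by exists t, c, r, G, S, ys, q; split=> //; move: m_eq; lia.
  case: t m_eq tr => [|t] m_eq tr; first by rewrite addn0 mul0n in m_eq.
  have [c' [r' [tr' c'R c'sep]]] := round_next tr rnd.
  exists t, c', r', [::], [set: {ffun 'I_d -> bool}]%SET, [::], (k ^ 2).-1.
  have k2 : (0 < k ^ 2)%N by rewrite expn_gt0 k_gt0.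
  split=> //; first by move: m_eq; rewrite mulSn; lia.
  by rewrite prednK //; apply: round_start.
case Ey: (tau y) => [B|//].
have [[ys' rnd']|[u uB rnd']] := round_step b rnd1 Ey; [left|right].
  exact: IHm m_eq1 tr1 rnd'.
by exists u => // a /rnd'[G' [S' [ys']]]; apply: IHm m_eq1 tr1.
Qed.

(** Each round divides the radius by [6 * d], so [t] rounds can be played between
    the radii [R] and [rho]. *)
Theorem survives_all_rounds t : rho * (6 * d%:R) ^+ t <= R -> (0 < t)%N ->
  survives (t * k ^ 2) (fun=> Open [::]).
Proof.
case: t => // t tR _.
apply: (@round_survives _ t 0 R [::] [set: {ffun 'I_d -> bool}]%SET [::] (k ^ 2)) => //.
  by rewrite mulSn addnC.
by apply: round_start => [j|y]; [rewrite mxE normr0 add0r|left].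
Qed.

End Rounds.

(** * Separation of a point from a compact convex set *)

Section MixedSpace.
Context {K : realType} {n d : nat}.
Local Notation space := ('rV[K]_n * 'rV[K]_d)%type.
Implicit Types (u v w z : space) (C : set (space)).

Lemma innerE u v : inner u v = dot u.1 v.1 + dot u.2 v.2.
Proof. by []. Qed.

Lemma innerDr u v w : inner u (v + w) = inner u v + inner u w.
Proof. by rewrite !innerE !dotDr addrACA. Qed.

Lemma innerZr (a : K) u v : inner u (a *: v) = a * inner u v.
Proof. by rewrite !innerE !dotZr mulrDr. Qed.

Lemma innerC u v : inner u v = inner v u.
Proof. by rewrite !innerE !(dotC u.1) !(dotC u.2). Qed.

Lemma innerBr u v w : inner u (v - w) = inner u v - inner u w.
Proof. by rewrite innerDr -scaleN1r innerZr mulN1r. Qed.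

Lemma inner0l u : inner 0 u = 0.
Proof. by rewrite innerC -(scale0r 0) innerZr mul0r. Qed.

Lemma inner_sqrB u v (a : K) : inner (a *: u - v) (a *: u - v) =
  a ^+ 2 * inner u u - 2 * a * inner v u + inner v v.
Proof.
rewrite innerBr innerZr ![inner (_ - v) _]innerC !innerBr !innerZr.
by rewrite (innerC u v); ring.
Qed.

Lemma inner_gt0 u : u != 0 -> 0 < inner u u.
Proof.
move=> u0; rewrite innerE lt_neqAle addr_ge0 ?dot_self_ge0 // andbT eq_sym.
apply: contra_neq u0 => /eqP; rewrite paddr_eq0 ?dot_self_ge0 // => /andP[u1 u2].
have zero m (v : 'rV[K]_m) : dot v v == 0 -> v = 0.
  move=> v0; apply/rowP => j; rewrite mxE; apply/eqP; apply: contraTT v0 => vj.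
  by rewrite gt_eqF // (dot_self_gt0 vj).
by case: u u1 u2 => x y /= /zero -> /zero ->.
Qed.

Lemma inner_continuous u : continuous (inner u).
Proof.
have coordC m (f : space -> 'rV[K]_m) (x : 'rV[K]_m) : continuous f ->
    continuous (fun w => dot x (f w)).
  move=> fC; rewrite /dot; apply: continuous_big => [|j _ w].
    exact: add_continuous.
  apply: cvgM; first exact: cvg_cst.
  exact: (continuous_comp (fC w) (@coord_continuous _ _ _ 0 j (f w))).
move=> w; apply: cvgD; apply: coordC => x; [exact: cvg_fst|exact: cvg_snd].
Qed.

Lemma sqr_dist_continuous z : continuous (fun w => inner (w - z) (w - z)).
Proof.
have coordC m (f : space -> 'rV[K]_m) : continuous f ->
    continuous (fun w => dot (f w) (f w)).
  move=> fC; rewrite /dot; apply: continuous_big => [|j _ w].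
    exact: add_continuous.
  by apply: cvgM; exact: (continuous_comp (fC w) (@coord_continuous _ _ _ 0 j (f w))).
have c1 : continuous (fun w : space => w.1 - z.1).
  by move=> w; apply: cvgB; [exact: cvg_fst|exact: cvg_cst].
have c2 : continuous (fun w : space => w.2 - z.2).
  by move=> w; apply: cvgB; [exact: cvg_snd|exact: cvg_cst].
by move=> w; exact: (cvgD (coordC _ _ c1 w) (coordC _ _ c2 w)).
Qed.

Lemma convex_setP C : convex_set C <-> forall x y (t : K), 0 <= t -> t <= 1 ->
  C x -> C y -> C (t *: x + (1 - t) *: y).
Proof.
split=> [Cc x y t t0 t1 Cx Cy|H x y t].
  have := Cc x y (Itv01 t0 t1); rewrite !inE => /(_ Cx Cy); exact.
by rewrite !inE => Cx Cy; apply: H.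
Qed.

(** The normal is [z - c] for the point [c] of [C] nearest to [z]. *)
Lemma separation (R : K) C z : (0 < d)%N -> closed C -> convex_set C ->
  (forall w, C w -> (forall i, - R <= w.1 0 i <= R) /\
                    (forall j, - R <= w.2 0 j <= R)) ->
  ~ C z -> exists2 g, g != 0 & forall w, C w -> inner g w < inner g z.
Proof.
move=> d_gt0 Ccl /convex_setP Ccv Cbd Cz.
(* An empty [C] is separated by any nonzero vector; one exists as [0 < d]. *)
have [[w0 Cw0]|C0] := pselect (C !=set0); last first.
  exists (0, const_mx 1); last by move=> w Cw; case: C0; exists w.
  apply/eqP => -[/rowP/(_ (Ordinal d_gt0))]; rewrite !mxE => /eqP.
  by rewrite oner_eq0.
have Ccpt : compact C.
  apply: (@subclosed_compact _ _ ([set x : 'rV[K]_n | forall i, `[- R, R]%classic (x 0 i)] `*`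
     [set x : 'rV[K]_d | forall j, `[- R, R]%classic (x 0 j)])) => //.
    apply: compact_setX;
      exact: (@rV_compact K _ (fun=> `[- R, R]%classic) (fun=> @segment_compact _ _ _)).
have [c cC cmin] : exists2 c, c \in C &
    forall t, t \in C -> inner (c - z) (c - z) <= inner (t - z) (t - z).
  apply: (compact_EVT_min _ Ccpt); first by exists w0.
  by apply: continuous_subspaceT => x; apply: sqr_dist_continuous.
rewrite inE in cC.
have zc : z - c != 0 by rewrite subr_eq0; apply/eqP => zc; apply: Cz; rewrite zc.
exists (z - c) => // w Cw.
have := inner_gt0 zc; set g := z - c => gg.
suff : inner g (w - c) <= 0 by move: gg; rewrite {2}/g !innerBr; lra.
rewrite leNgt; apply/negP => p_gt0; set p := inner g (w - c) in p_gt0.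
pose N := inner (w - c) (w - c).
have N_ge0 : 0 <= N by rewrite addr_ge0 ?dot_self_ge0.
(* Moving from [c] towards [w] by this fraction would come closer to [z]. *)
pose t := p / (N + p); have Np : 0 < N + p by lra.
have t_gt0 : 0 < t by rewrite divr_gt0.
have t_le1 : t <= 1 by rewrite ler_pdivrMr // mul1r lerDr.
have /cmin : t *: w + (1 - t) *: c \in C.
  by rewrite inE; apply: Ccv => //; exact: ltW.
have -> : t *: w + (1 - t) *: c - z = t *: (w - c) - g.
  by rewrite scalerBl scale1r scalerBr /g opprB [c - _]addrC !addrA.
have -> : c - z = 0 *: (w - c) - g by rewrite scale0r sub0r opprB.
rewrite !inner_sqrB -/p -/N.
have : t * (N + p) = p by rewrite /t mulfVK // gt_eqF.
move: t t_gt0 t_le1 {Np} => t t_gt0 t_le1 tp.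
have : 0 < t * p by rewrite mulr_gt0.
nra.
Qed.

End MixedSpace.

(** * Vertices of the unit cube and convex hulls *)

Section Vertices.
Context {K : realType} {n : nat}.
Implicit Types (x : 'rV[K]_n) (s t : {ffun 'I_n -> bool}).

Definition vertex s : 'rV[K]_n := \row_i (s i)%:R.

(** At a vertex [x], the linear form of this vector attains its maximum over the
    unit cube at [x] only. *)
Definition outward x : 'rV[K]_n := \row_i (2 * x 0 i - 1).

Definition is_vertex x := exists s, x = vertex s.

Lemma vertex_inj : injective vertex.
Proof.
move=> s t /rowP st; apply/ffunP => i; have := st i; rewrite !mxE => /eqP.
by rewrite eqr_nat; case: (s i) (t i) => [] [].
Qed.

Lemma outward_neq0 s i : outward (vertex s) 0 i != 0.
Proof. by rewrite !mxE; case: (s i); apply/eqP => /= ?; lra. Qed.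

Let outward_term s x : dot (outward (vertex s)) (vertex s) - dot (outward (vertex s)) x =
  \sum_i (if s i then 1 - x 0 i else x 0 i).
Proof.
rewrite -dotBr; apply: eq_bigr => i _; rewrite !mxE.
by case: (s i); rewrite /= ?mulr1n ?mulr0n; ring.
Qed.

Lemma outward_le s x i : (forall i, 0 <= x 0 i <= 1) ->
  (if s i then 1 - x 0 i else x 0 i) <=
    dot (outward (vertex s)) (vertex s) - dot (outward (vertex s)) x.
Proof.
move=> x01; rewrite outward_term (bigD1 i) //= lerDl; apply: sumr_ge0 => j _.
by case: (s j); have := x01 j; lra.
Qed.

Lemma outward_lt s x : (forall i, 0 <= x 0 i <= 1) -> x <> vertex s ->
  dot (outward (vertex s)) x < dot (outward (vertex s)) (vertex s).
Proof.
move=> x01 xs; rewrite -subr_gt0.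
have /existsP[i xi] : [exists i, x 0 i != vertex s 0 i].
  rewrite -negb_forall; apply/negP => /forallP H; apply: xs.
  by apply/rowP => i; apply/eqP/H.
apply: lt_le_trans (outward_le s i x01); have := x01 i; move: xi; rewrite mxE neq_lt.
by case: (s i) => /=; lra.
Qed.

Lemma vertex01 s i : 0 <= vertex s 0 i <= 1.
Proof. by rewrite mxE; case: (s i) => /=; lra. Qed.

Lemma outward_vertex s t : s != t ->
  dot (outward (vertex s)) (vertex t) <= dot (outward (vertex s)) (vertex s) - 1.
Proof.
move=> st; have /existsP[i sti] : [exists i, s i != t i].
  rewrite -negb_forall; apply: contraNN st => /forallP H.
  by apply/eqP/ffunP => i; apply/eqP/H.
have := outward_le s i (vertex01 t); rewrite mxE.
by case: (s i) (t i) sti => [] [] //= _; lra.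
Qed.

Lemma int_vertex x : (forall i, 0 <= x 0 i <= 1) ->
  (forall i, x 0 i \is a Num.int) -> is_vertex x.
Proof.
move=> x01 xint; exists [ffun i => x 0 i == 1]; apply/rowP => i; rewrite mxE ffunE.
have /intrP[m xm] := xint i; have := x01 i; rewrite {}xm.
rewrite ler0z (_ : (m%:~R <= 1 :> K) = (m <= 1)) => [m01|]; last by rewrite -(ler_int K).
have [->|->] : m = 0 \/ m = 1 by lia.
  by rewrite eq_sym oner_eq0.
by rewrite eqxx.
Qed.

End Vertices.

Section FiniteChoices.
Context {K : realType} (I : eqType).
Implicit Types (L : seq I) (P : I -> Prop) (f h : I -> K).

Lemma small_scale L P f h : (forall i, i \in L -> P i -> 0 < h i) ->
  exists2 a : K, 0 < a & forall b, 0 < b -> b <= a ->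
    forall i, i \in L -> P i -> b * f i < h i.
Proof.
elim: L => [|i L IHL] hL; first by exists 1.
have [|a a0 aL] := IHL; first by move=> j jL; apply: hL; rewrite inE jL orbT.
have [b b0 bi] : exists2 b : K, 0 < b &
    forall b', 0 < b' -> b' <= b -> P i -> b' * f i < h i.
  have [Pi|nPi] := pselect (P i); last by exists 1.
  have hi : 0 < h i by apply: hL Pi; rewrite mem_head.
  have D0 : 0 < `|f i| + 1 by rewrite ltr_wpDl.
  exists (h i / (`|f i| + 1)); first by rewrite divr_gt0.
  move=> b' b'0; rewrite ler_pdivlMr // => b'h _.
  by have := ler_wpM2l (ltW b'0) (ler_norm (f i)); lra.
exists (Num.min a b) => [|c c0]; first by rewrite lt_min a0.
rewrite le_min => /andP[ca cb] j; rewrite inE => /predU1P[->|jL]; first exact: bi.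
exact: aL.
Qed.

Lemma strict_bound L P f (t t0 : K) : t0 < t ->
  (forall i, i \in L -> P i -> f i < t) ->
  exists b, [/\ b < t, t0 <= b & forall i, i \in L -> P i -> f i <= b].
Proof.
move=> t0t; elim: L => [|i L IHL] fL; first by exists t0.
have [|b [bt t0b bL]] := IHL; first by move=> j jL; apply: fL; rewrite inE jL orbT.
have [Pi|nPi] := pselect (P i); last first.
  by exists b; split=> // j; rewrite inE => /predU1P[->//|]; apply: bL.
exists (Num.max b (f i)); split; first by rewrite gt_max bt fL ?mem_head.
  by rewrite le_max t0b.
move=> j; rewrite inE le_max => /predU1P[-> _|jL Pj]; first by rewrite lexx orbT.
by rewrite bL.
Qed.

End FiniteChoices.

Section Hull.
Context {K : realType} {n d : nat}.
Local Notation space := ('rV[K]_n * 'rV[K]_d)%type.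
Implicit Types (g w z : space) (Q : set space).

(** The closed convex hull, as the intersection of all closed half-spaces (and, for
    [g = 0], of the whole space or nothing) that contain [Q]: closedness and
    convexity are immediate. *)
Definition hull Q : set space :=
  [set w | forall g b, (forall q, Q q -> inner g q <= b) -> inner g w <= b].

Lemma sub_hull Q q : Q q -> hull Q q.
Proof. by move=> Qq g b; apply. Qed.

Lemma hull_closed Q : closed (hull Q).
Proof.
have -> : hull Q = \bigcap_(p in [set p : space * K | forall q, Q q -> inner p.1 q <= p.2])
    [set w | inner p.1 w <= p.2].
  by apply/seteqP; split=> [w Qw [g b] /= gb|w Qw g b gb]; [exact: Qw|exact: (Qw (g, b))].
apply: closed_bigI => -[g b] _ /=.
apply: (@preimage_closed _ _ (inner g) [set y | y <= b]) => [w _|].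
  exact: inner_continuous.
exact: closed_le.
Qed.

Lemma hull_convex Q : convex_set (hull Q).
Proof.
apply/convex_setP => x y t t0 t1 Qx Qy g b gb.
rewrite innerDr !innerZr.
have := ler_wpM2l t0 (Qx g b gb).
have : 0 <= 1 - t by lra.
by move=> /ler_wpM2l/(_ _ _ (Qy g b gb)); lra.
Qed.

Lemma hull_lt Q g t w b : (forall q, Q q -> inner g q <= b) -> b < t ->
  hull Q w -> inner g w < t.
Proof. by move=> gb bt Qw; apply: le_lt_trans bt; apply: Qw. Qed.

End Hull.

(** * The mixed-integer game *)

Section MixedGame.
Context {K : realType} {n d : nat} (R rho : K) (M : nat).
Local Notation space := ('rV[K]_n * 'rV[K]_d)%type.
Local Notation cell := {ffun 'I_n -> bool}.
Local Notation state := (space -> status K d space).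
Hypotheses (R_gt0 : 0 < R) (rho_gt0 : 0 < rho) (R_ge1 : (0 < n)%N -> 1 <= R).
Implicit Types (g w z : space) (s t : cell) (sigma : state) (cnt : cell -> nat).

Definition box z :=
  (forall i, 0 <= z.1 0 i <= 1) /\ (forall j, - R <= z.2 0 j <= R).

(** The normals at [z] that agree with all answers given there.  Nothing is
    prescribed at a point never asked about: it may even belong to the instance. *)
Definition allowed sigma z : set space :=
  match sigma z with
  | Open [::] => setT
  | Open B => [set g | g.1 = outward z.1 /\ orth B g.2]
  | Fixed g => [set g]
  end.

Definition slice sigma s : 'rV[K]_d -> status K d 'rV[K]_d := fun y =>
  match sigma (vertex s, y) with
  | Open B => Open B
  | Fixed g => Fixed g.2
  end.

(** The points accepted into the instance; they lie outside the fibers of the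
    vertices. *)
Definition member sigma z := ~ is_vertex z.1 /\ sigma z = Fixed 0.

(** The invariant of the game with [N] questions to go, [cnt s] being the number of
    questions asked in the fiber of [vertex s].  Outside the fibers, a point is
    accepted, or has the normal of a face of the box, or copies the normal of a
    point of a fiber that excludes it.  In a fiber, the middle condition of
    [cons_vertex] says that the second component of the normal is too small to
    outweigh the first one at other vertices, which [outward_vertex] separates by
    at least 1.  A fiber asked more than [M] questions is given up. *)
Record consistent (N : nat) sigma cnt : Prop := Consistent {
  cons_finite : exists D : seq space, forall z, sigma z <> Open [::] -> z \in D;
  cons_other : forall z, ~ is_vertex z.1 -> sigma z <> Open [::] ->
    exists2 g, sigma z = Fixed g &
      [\/ g = 0 /\ box z,
          g != 0 /\ forall w, box w -> inner g w < inner g z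
        | exists z', [/\ is_vertex z'.1, sigma z' = Fixed g & inner g z' <= inner g z]];
  cons_vertex : forall z g, is_vertex z.1 -> sigma z = Fixed g ->
    [/\ g.1 = outward z.1, R * l1norm g.2 - dot g.2 z.2 < 1 &
        forall w, member sigma w -> inner g w < inner g z];
  cons_count : (\sum_s cnt s + N <= 2 ^ n * M)%N;
  cons_alive : forall s, (cnt s <= M)%N -> survives R rho (M - cnt s) (slice sigma s) }.

Lemma slice_update sigma s y x t : slice (update sigma (vertex s, y) x) t =
  if t == s then update (slice sigma s) y
    (match x with Open B => Open B | Fixed g => Fixed g.2 end) else slice sigma t.
Proof.
apply/funext => y'; rewrite /slice /update xpair_eqE (inj_eq vertex_inj).
by case: eqP => [->|]; case: eqP.
Qed.

Lemma slice_update_other sigma z x t : ~ is_vertex z.1 ->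
  slice (update sigma z x) t = slice sigma t.
Proof.
move=> zv; apply/funext => y; rewrite /slice /update; case: eqP => // zE.
by case: zv; rewrite -zE; exists t.
Qed.

Lemma consistent_start : survives R rho M (fun _ : 'rV[K]_d => Open [::]) ->
  consistent (2 ^ n * M) (fun=> Open [::]) (fun=> 0%N).
Proof.
move=> surv; split=> //; first by exists [::].
  by rewrite sum_nat_const muln0.
by move=> s _; rewrite subn0.
Qed.

Lemma consistent_leq N N' sigma cnt : (N <= N')%N ->
  consistent N' sigma cnt -> consistent N sigma cnt.
Proof. by move=> NN' [? ? ? ? ?]; split=> //; lia. Qed.

Lemma member_box N sigma cnt w : consistent N sigma cnt -> member sigma w -> box w.
Proof.
move=> [_ other vert _ _] mw; have [wv w0] := mw.
have [|g] := other _ wv; first by rewrite w0.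
rewrite w0 => -[<-] [[_ //]|[]|[z' [z'v z'0 _]]]; first by rewrite eqxx.
by have [_ _ /(_ _ mw)] := vert _ _ z'v z'0; rewrite !inner0l ltxx.
Qed.

Lemma member_vertex N sigma cnt w s : consistent N sigma cnt -> member sigma w ->
  dot (outward (vertex s)) w.1 < dot (outward (vertex s)) (vertex s).
Proof.
move=> cons mw; have [w01 _] := member_box cons mw.
by apply: outward_lt => // ws; case: mw => -[]; exists s.
Qed.

Lemma update_finite sigma z x :
  (exists D : seq space, forall w, sigma w <> Open [::] -> w \in D) ->
  exists D : seq space, forall w, update sigma z x w <> Open [::] -> w \in D.
Proof.
move=> [D HD]; exists (z :: D) => w; rewrite /update inE.
by case: eqP => //= _; apply: HD.
Qed.

Definition answered sigma v z := exists a : K, forall g, allowed sigma z g -> inner v g = a.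

(** In a live fiber the answer is the one of the continuous game, with the multiple
    [a] of its normal small enough for the bounds in [cons_vertex].  In a fiber
    given up, replying as for the second component 0 stays consistent for ever:
    [outward] alone separates the fiber from everything else. *)
Lemma vertex_step N sigma cnt s y B v : consistent N.+1 sigma cnt ->
  sigma (vertex s, y) = Open B ->
  exists sigma' cnt', [/\ (forall z g, allowed sigma' z g -> allowed sigma z g),
    answered sigma' v (vertex s, y) & consistent N sigma' cnt'].
Proof.
move=> cons Ez; have [fin other vert count alive] := cons.
pose z : space := (vertex s, y).
pose cnt' t := (cnt t + (t == s))%N.
have count' : (\sum_t cnt' t + N <= 2 ^ n * M)%N.
  have sum1 : (\sum_t (t == s) = 1)%N by rewrite (bigD1 s) //= eqxx big1 // => t /negPf ->.
  by rewrite big_split /= sum1 addn1 addSnnS.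
have zv : is_vertex z.1 by exists s.
have member_upd x w : member (update sigma z x) w -> member sigma w.
  by rewrite /member /update; case: eqP => [-> [/(_ zv)]|].
have other_upd x w : (forall g, sigma z <> Fixed g) -> ~ is_vertex w.1 ->
    update sigma z x w <> Open [::] ->
    exists2 g, update sigma z x w = Fixed g &
      [\/ g = 0 /\ box w,
          g != 0 /\ forall w', box w' -> inner g w' < inner g w
        | exists z', [/\ is_vertex z'.1, update sigma z x z' = Fixed g &
            inner g z' <= inner g w]].
  move=> zF wv; rewrite /update; case: eqP => [wz|_ /(other _ wv)[g Ew H]].
    by rewrite wz in wv.
  exists g => //; case: H => [|| [z' [z'v Ez' le]]]; [exact: Or31|exact: Or32|apply: Or33].
  by exists z'; split=> //; case: eqP => // z'z; case: (zF g); rewrite -z'z.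
have znF g : sigma z <> Fixed g by rewrite Ez.
have alive' x : (forall m, (M - cnt s = m.+1)%N ->
      survives R rho m (update (slice sigma s) y
        (match x with Open B => Open B | Fixed g => Fixed g.2 end))) ->
    forall t, (cnt' t <= M)%N -> survives R rho (M - cnt' t) (slice (update sigma z x) t).
  move=> surv t; rewrite slice_update /cnt'; case: eqP => [->|_] tM.
    by apply: surv; move: tM; rewrite /=; lia.
  by rewrite addn0; apply: alive; move: tM; rewrite /=; lia.
have open_ok : (forall m, (M - cnt s = m.+1)%N ->
      survives R rho m (update (slice sigma s) y (Open (v.2 :: B)))) ->
    exists sigma' cnt', [/\ (forall z g, allowed sigma' z g -> allowed sigma z g),
    answered sigma' v (vertex s, y) & consistent N sigma' cnt'].
  move=> surv; exists (update sigma z (Open (v.2 :: B))), cnt'; split.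
  - move=> w g; rewrite /allowed /update; case: eqP => [->|//]; rewrite Ez.
    case: B {Ez surv} => // b B [g1 gB]; split=> // b' b'B; apply: gB.
    by rewrite inE b'B orbT.
  - exists (dot v.1 (outward (vertex s))) => g; rewrite /allowed /update eqxx => -[g1 gB].
    by rewrite innerE g1 gB ?mem_head // addr0.
  - split=> //; [exact: update_finite|by move=> w; apply: other_upd| |exact: alive'].
    move=> w g wv; rewrite {1}/update; case: eqP => // _ /(vert _ _ wv)[g1 g2 gm].
    by split=> // w' /member_upd/gm.
have [sM|Ms] := ltnP (cnt s) M; last by apply: open_ok => m; lia.
have := alive s (ltnW sM); case Em: (M - cnt s)%N => [|m]; first by move: Em sM; lia.
move=> [_ /(_ y v.2)]; rewrite /slice /= -/z Ez => -[surv|[u uB surv]].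
  by apply: open_ok => m'; rewrite Em => -[<-].
have [D HD] := fin.
(* [a1] keeps the accepted points on the lower side, [a2] the other fibers. *)
have [a1 a1_gt0 small1] := @small_scale _ _ D (member sigma)
   (fun w => dot u w.2 - dot u y)
   (fun w => dot (outward (vertex s)) (vertex s) - dot (outward (vertex s)) w.1)
   (fun w _ mw => etrans (subr_gt0 _ _) (member_vertex s cons mw)).
have [a2 a2_gt0 small2] := @small_scale K unit [:: tt] (fun=> True)
   (fun=> R * l1norm u - dot u y) (fun=> 1) (fun _ _ _ => ltr01).
pose a := Num.min a1 a2; have a_gt0 : 0 < a by rewrite lt_min a1_gt0.
pose g0 : space := (outward (vertex s), a *: u).
exists (update sigma z (Fixed g0)), cnt'; split.
- move=> w g; rewrite /allowed /update; case: eqP => [->|//] -> /=; rewrite Ez.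
  case: B {Ez open_ok} uB => // b B uB; split=> // b' b'B.
  by rewrite dotZr uB ?mulr0.
- by exists (inner v g0) => g; rewrite /allowed /update eqxx => ->.
- split=> //; [exact: update_finite|by move=> w; apply: other_upd| |].
    move=> w g wv; rewrite {1}/update.
    case: eqP => [-> [<-]|_ /(vert _ _ wv)[g1 g2 gm]]; last first.
      by split=> // w' /member_upd/gm.
    split=> //=.
      rewrite l1normZ dotZl gtr0_norm //.
      have := small2 a a_gt0 _ tt (mem_head _ _) I; rewrite ge_min lexx orbT => /(_ isT); lra.
    move=> w' /member_upd mw'; have := small1 a a_gt0 _ w' (HD _ _) mw'.
    rewrite ge_min lexx => /(_ isT); case: (mw') => _ -> /(_ ltac:(done)).
    by rewrite !innerE /= !dotZl; lra.
  by apply: alive' => m'; rewrite Em => -[<-]; apply: surv.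
Qed.

Lemma not_box z : ~ box z ->
  exists2 g, g != 0 & forall w, box w -> inner g w < inner g z.
Proof.
have delta m (i : 'I_m) x : dot (delta_mx 0 i : 'rV[K]_m) x = x 0 i.
  rewrite /dot (bigD1 i) //= big1 ?addr0 ?mxE ?eqxx ?mul1r // => j /negPf ji.
  by rewrite mxE ji andbF mul0r.
have delta0 m (i : 'I_m) (b : K) : b != 0 -> b *: delta_mx 0 i != 0 :> 'rV[K]_m.
  move=> b0; apply/eqP => /rowP/(_ i); rewrite !mxE !eqxx mulr1 => /eqP.
  by rewrite (negPf b0).
have pair1 (x : 'rV[K]_n) : x != 0 -> ((x, 0) : space) != 0.
  by apply: contraNN => /eqP[->].
have pair2 (x : 'rV[K]_d) : x != 0 -> ((0, x) : space) != 0.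
  by apply: contraNN => /eqP[->].
have N1 : (-1 : K) != 0 by rewrite oppr_eq0 oner_eq0.
move=> zb; apply: contrapT => none; apply: zb; split=> [i|j]; apply/andP; split;
  rewrite leNgt; apply/negP => out; apply: none.
- exists (-1 *: delta_mx 0 i, 0); first exact/pair1/delta0.
  by move=> w [/(_ i) wi _]; rewrite !innerE /= !dot0l !addr0 !dotZl !delta; lra.
- exists (1 *: delta_mx 0 i, 0); first exact/pair1/delta0/oner_neq0.
  by move=> w [/(_ i) wi _]; rewrite !innerE /= !dot0l !addr0 !dotZl !delta; lra.
- exists (0, -1 *: delta_mx 0 j); first exact/pair2/delta0.
  by move=> w [_ /(_ j) wj]; rewrite !innerE /= !dot0l !add0r !dotZl !delta; lra.
- exists (0, 1 *: delta_mx 0 j); first exact/pair2/delta0/oner_neq0.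
  by move=> w [_ /(_ j) wj]; rewrite !innerE /= !dot0l !add0r !dotZl !delta; lra.
Qed.

(** A point outside the fibers exists only if [n] is positive, and then [outward]
    does not vanish. *)
Lemma vertex_normal_neq0 N sigma cnt z w g : consistent N sigma cnt ->
  ~ is_vertex z.1 -> is_vertex w.1 -> sigma w = Fixed g -> g <> 0.
Proof.
move=> cons zv wv Ew g0; have [g1 _ _] := cons_vertex cons wv Ew.
apply: zv; exists [ffun=> false]; apply/rowP => i.
have [s ws] := wv; have := outward_neq0 (K := K) s i.
by rewrite -ws -g1 g0 mxE eqxx.
Qed.

(** If a normal fixed in some fiber excludes [z], it also serves as the normal at
    [z]: whatever it separates from the point of the fiber it separates from [z].
    Otherwise accepting [z] contradicts no answer, unless [z] is outside the box.
    The normals still open in the fibers will not exclude it: their second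
    component can be scaled down when they are fixed. *)
Lemma other_step N sigma cnt z v : consistent N sigma cnt ->
  ~ is_vertex z.1 -> sigma z = Open [::] ->
  exists sigma', [/\ (forall w g, allowed sigma' w g -> allowed sigma w g),
    answered sigma' v z & consistent N sigma' cnt].
Proof.
move=> cons zv Ez; have [fin other vert count alive] := cons.
have fix_ok g :
    [\/ g = 0 /\ box z /\ (forall w h, is_vertex w.1 -> sigma w = Fixed h ->
          inner h z < inner h w),
        g != 0 /\ forall w, box w -> inner g w < inner g z
      | exists z', [/\ is_vertex z'.1, sigma z' = Fixed g & inner g z' <= inner g z]] ->
    exists sigma', [/\ (forall w g, allowed sigma' w g -> allowed sigma w g),
      answered sigma' v z & consistent N sigma' cnt].
  move=> Hg.
  have upd_vertex w : is_vertex w.1 -> update sigma z (Fixed g) w = sigma w.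
    by rewrite /update; case: eqP => // ->.
  have member_upd w : member (update sigma z (Fixed g)) w ->
      member sigma w \/ w = z /\ g = 0.
    rewrite /member /update; by case: eqP => [-> [_ [g0]]|_ mw]; [right|left].
  exists (update sigma z (Fixed g)); split.
  - by move=> w h; rewrite /allowed /update; case: eqP => [->|//]; rewrite Ez.
  - by exists (inner v g) => h; rewrite /allowed /update eqxx => ->.
  - split=> //; first exact: update_finite.
    + move=> w wv; have [->|wz] := eqVneq w z.
        rewrite {1}/update eqxx => _; exists g; first by rewrite /update eqxx.
        case: Hg => [[? [? _]]|?|[z' [z'v Ez' le]]]; [exact: Or31|exact: Or32|].
        by apply: Or33; exists z'; rewrite upd_vertex.
      rewrite {1}/update (negPf wz) => /(other _ wv)[h Ew H].
      exists h; first by rewrite /update (negPf wz).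
      case: H => [|| [z' [z'v Ez' le]]]; [exact: Or31|exact: Or32|].
      by apply: Or33; exists z'; rewrite upd_vertex.
    + move=> w h wv; rewrite upd_vertex // => Ew; have [h1 h2 hm] := vert _ _ wv Ew.
      split=> // w' /member_upd[/hm //|[-> g0]].
      case: Hg => [[_ [_ H]]|[]|[z' [z'v Ez' _]]]; first exact: H Ew.
        by rewrite g0 eqxx.
      by case: (vertex_normal_neq0 cons zv z'v Ez').
    + by move=> s sM; rewrite slice_update_other //; apply: alive.
case: (pselect (exists z' g,
  [/\ is_vertex z'.1, sigma z' = Fixed g & inner g z' <= inner g z])).
  by move=> [z' [g H]]; apply: (fix_ok g); apply: Or33; exists z'.
move=> none; case: (pselect (box z)) => [zb|/not_box[g g0 gb]].
  apply: (fix_ok 0); apply: Or31; split=> //; split=> // w h wv Ew.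
  by rewrite ltNge; apply/negP => le; apply: none; exists w, h.
by apply: (fix_ok g); apply: Or32.
Qed.

Lemma game_step N sigma cnt z v : consistent N.+1 sigma cnt ->
  exists sigma' cnt', [/\ (forall w g, allowed sigma' w g -> allowed sigma w g),
    answered sigma' v z & consistent N sigma' cnt'].
Proof.
move=> cons; have consN := consistent_leq (leqnSn N) cons.
case Ez: (sigma z) => [B|g]; last first.
  exists sigma, cnt; split=> //; exists (inner v g) => h.
  by rewrite /allowed Ez => ->.
have [[s zs]|zv] := pselect (is_vertex z.1).
  case: z zs Ez => [x y] /= -> Ez; exact: (vertex_step v cons Ez).
case: B Ez => [|b B] Ez.
  by have [sigma' H] := other_step v consN zv Ez; exists sigma', cnt.
have [|g] := cons_other cons zv; first by rewrite Ez.
by rewrite Ez.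
Qed.

(** Along the branch of the algorithm that follows the answers of the adversary,
    either a report is reached or [N] questions are asked. *)
Lemma play (A : Type) (Q : set (query K n d A)) (alg : algorithm K n d A) N sigma cnt :
  (forall q, Q q -> exists v phi, forall g, q g = phi (inner v g)) ->
  permissible Q alg -> consistent N sigma cnt ->
  exists N' sigma' cnt', [/\ consistent N' sigma' cnt',
    (forall w g, allowed sigma' w g -> allowed sigma w g) &
    (exists r, forall G, (forall w, allowed sigma' w (G w)) -> output G alg = r) \/
    (forall G, (forall w, allowed sigma' w (G w)) -> (N <= num_queries G alg)%N)].
Proof.
move=> Q_inner; elim: N sigma cnt alg => [|N IHN] sigma cnt alg perm cons.
  by exists 0%N, sigma, cnt; split=> //; right.
case: alg perm => [r|z q next] /= perm.
  by exists N.+1, sigma, cnt; split=> //; left; exists r.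
have [/Q_inner[v [phi qE]] perm_next] := perm.
have [sigma1 [cnt1 [sub1 [a ans] cons1]]] := game_step z v cons.
have [N' [sigma' [cnt' [cons' sub' outcome]]]] := IHN _ _ _ (perm_next (phi a)) cons1.
have qa G : (forall w, allowed sigma' w (G w)) -> q (G z) = phi a.
  by move=> GA; rewrite qE (ans (G z)) //; apply: sub'.
exists N', sigma', cnt'; split=> //; first by move=> w g /sub'/sub1.
case: outcome => [[r Hr]|H]; [left; exists r|right] => G GA; rewrite qa //.
  exact: Hr.
exact: H.
Qed.

(** More than [M] questions in each of the [2 ^ n] fibers would be too many. *)
Lemma alive_cell N sigma cnt : consistent N sigma cnt ->
  exists s c, inside R c rho /\ separable c rho (slice sigma s).
Proof.
move=> [_ _ _ count alive].
have /existsP[s sM] : [exists s, (cnt s <= M)%N].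
  rewrite -[X in is_true X]negbK negb_exists; apply/negP => /forallP H.
  move: count; apply/negP; rewrite -ltnNge; apply: leq_trans (leq_addr _ _).
  apply: (@leq_trans (\sum_(s : cell) M.+1)).
    by rewrite sum_nat_const card_ffun card_bool card_ord ltn_pmul2l ?expn_gt0.
  by apply: leq_sum => s _; rewrite ltnNge.
exists s; have := alive s sM; case: (M - cnt s)%N => [|m] [[c cR csep] _];
  by exists c.
Qed.

(** The cube left in the fiber of [vertex s] by the continuous game. *)
Definition block s (c : 'rV[K]_d) : set space :=
  [set w : space | w.1 = vertex s /\ forall j, `|w.2 0 j - c 0 j| <= rho].

Definition valid (C : set space) z g :=
  (C z -> g = 0) /\ (~ C z -> g != 0 /\ forall w, C w -> inner g w < inner g z).

Definition separates_block s (c : 'rV[K]_d) sigma z g :=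
  [/\ allowed sigma z g,
      is_vertex z.1 -> forall w, member sigma w -> inner g w < inner g z &
      is_vertex z.1 -> inner g (vertex s, c) + rho * l1norm g.2 < inner g z].

Section Endgame.
Context (N : nat) (sigma : state) (cnt : cell -> nat) (s : cell) (c : 'rV[K]_d).
Hypotheses (cons : consistent N sigma cnt) (cR : inside R c rho)
  (csep : separable c rho (slice sigma s)).

(** A normal still open is completed in the surviving fiber with the separating
    normal of the continuous game, scaled down, and in the other fibers with 0. *)
Lemma exists_normal z : sigma z <> Open [::] -> exists g, separates_block s c sigma z g.
Proof.
move=> Ez; have [D HD] := cons_finite cons.
have [[t zt]|zv] := pselect (is_vertex z.1); last first.
  by have [g Eg _] := cons_other cons zv Ez; exists g; split=> //; rewrite /allowed Eg.
case Eq: (sigma z) => [B|g]; last first.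
  have zv : is_vertex z.1 by exists t.
  have [g1 g2 gm] := cons_vertex cons zv Eq.
  exists g; split=> // [|_]; first by rewrite /allowed Eq.
  rewrite !innerE /= g1 zt; have [ts|ts] := eqVneq t s.
    have := csep z.2; rewrite /slice -ts -zt -surjective_pairing Eq /below; lra.
  have := outward_vertex (K := K) ts.
  have : dot g.2 c <= (R - rho) * l1norm g.2.
    apply: le_trans (ler_norm _) (dot_le_l1norm _ _) => j.
    by rewrite lerBrDr.
  lra.
have [ts|ts] := eqVneq t s; last first.
  exists (outward z.1, 0); split=> [|_ w mw|_].
  - rewrite /allowed Eq; case: B {Eq} => // b B; split=> // b' _; exact: dot0r.
  - rewrite !innerE /= !dot0l !addr0 zt; exact: member_vertex cons mw.
  - rewrite !innerE /= !dot0l zt; have := outward_vertex (K := K) ts.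
    by rewrite /l1norm big1 => [|j _]; [lra|rewrite mxE normr0].
have := csep z.2; rewrite /slice -ts -zt -surjective_pairing Eq => -[B0|[u uB uz]].
  by case: Ez; rewrite Eq B0.
have [a a_gt0 small] := @small_scale _ _ D (member sigma)
   (fun w => dot u w.2 - dot u z.2)
   (fun w => dot (outward (vertex t)) (vertex t) - dot (outward (vertex t)) w.1)
   (fun w _ mw => etrans (subr_gt0 _ _) (member_vertex t cons mw)).
exists (outward z.1, a *: u); split=> [|_ w mw|_].
- rewrite /allowed Eq; case: B {Eq} uB => // b B uB; split=> // b' b'B.
  by rewrite dotZr uB ?mulr0.
- have := small a a_gt0 (lexx _) w (HD _ _) mw; case: (mw) => _ -> /(_ ltac:(done)).
  by rewrite !innerE /= !dotZl zt; lra.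
- have := below_scale a_gt0 uz; rewrite /below !innerE /= zt ts; lra.
Qed.

Lemma block_box w : block s c w -> box w.
Proof.
move=> [w1 w2]; split=> [i|j]; first by rewrite w1 vertex01.
have := w2 j; have := cR j; have := ler_normD (w.2 0 j - c 0 j) (c 0 j).
by rewrite subrK => H1 H2 H3; rewrite -ler_norml; lra.
Qed.

Lemma block_le g w : block s c w ->
  inner g w <= inner g (vertex s, c) + rho * l1norm g.2.
Proof.
move=> [w1 w2]; rewrite !innerE /= w1 -addrA lerD2l -lerBlDl -dotBr.
by apply: le_trans (ler_norm _) (dot_le_l1norm _ _) => j; rewrite !mxE.
Qed.

Lemma block_attained g : exists w, block s c w /\
  inner g w = inner g (vertex s, c) + rho * l1norm g.2.
Proof.
exists (vertex s, c + rho *: \row_j Num.sg (g.2 0 j)); split.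
  split=> // j; rewrite !mxE addrAC subrr add0r normrM (gtr0_norm rho_gt0).
  by rewrite ler_piMr ?(ltW rho_gt0) // normr_sg lern1 leq_b1.
rewrite !innerE /= dotDr dotZr addrA; congr (_ + _ * _).
by apply: eq_bigr => j _; rewrite mxE mulrC -normrEsg.
Qed.

Section Instance.
Context (Q : set space).
Hypotheses (memQ : forall w, member sigma w -> Q w)
  (Qmem : forall w, Q w -> member sigma w \/ block s c w).

Lemma hull_box w : hull Q w -> box w.
Proof.
move=> Qw; apply: contrapT => /not_box[g _ gb].
suff : inner g w < inner g w by rewrite ltxx.
have [D HD] := cons_finite cons.
have vc : inner g (vertex s, c) + rho * l1norm g.2 < inner g w.
  by have [q [/block_box/gb qw <-]] := block_attained g.
have [|b [bt b0 bD]] := @strict_bound _ _ D (member sigma) (inner g) _ _ vc.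
  by move=> q _ /(member_box cons)/gb.
apply: hull_lt bt Qw => q /Qmem[mq|/(block_le g)/le_trans]; last exact.
by apply: bD => //; apply: HD; case: mq => _ ->.
Qed.

Lemma hull_separated g z w : (forall q, member sigma q -> inner g q < inner g z) ->
  inner g (vertex s, c) + rho * l1norm g.2 < inner g z ->
  hull Q w -> inner g w < inner g z.
Proof.
move=> gm gc Qw; have [D HD] := cons_finite cons.
have [|b [bt b0 bD]] := @strict_bound _ _ D (member sigma) (inner g) _ _ gc.
  by move=> q _ /gm.
apply: hull_lt bt Qw => q /Qmem[mq|/(block_le g)/le_trans]; last exact.
by apply: bD => //; apply: HD; case: mq => _ ->.
Qed.

(** Both final instances are hulls of sets [Q] between the accepted points and the
    accepted points together with the block; the same normals are right for all
    of them. *)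
Lemma hull_valid gamma z :
  (forall w, sigma w <> Open [::] -> separates_block s c sigma w (gamma w)) ->
  sigma z <> Open [::] -> valid (hull Q) z (gamma z).
Proof.
move=> gammaP; have vertexP w : is_vertex w.1 -> sigma w <> Open [::] ->
    gamma w != 0 /\ forall q, hull Q q -> inner (gamma w) q < inner (gamma w) w.
  move=> wv /gammaP[_ /(_ wv) gm /(_ wv) gc]; split; last first.
    by move=> q; apply: hull_separated.
  apply: contraTneq gc => ->.
  by rewrite !inner0l /l1norm big1 ?mulr0 ?addr0 ?ltxx // => j _; rewrite mxE normr0.
have strict w g : g != 0 /\ (forall q, hull Q q -> inner g q < inner g w) ->
    valid (hull Q) w g.
  by move=> gw; split=> // Qw; have := gw.2 _ Qw; rewrite ltxx.
move=> Ez; have [zv|zv] := pselect (is_vertex z.1); first by apply/strict/vertexP.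
have [g Eg H] := cons_other cons zv Ez.
have -> : gamma z = g by have [+ _ _] := gammaP z Ez; rewrite /allowed Eg.
case: H => [[g0 zb]|[g0 gb]|[z' [z'v Ez' le]]].
- rewrite g0 in Eg *; split=> // nz; case: nz; apply/sub_hull/memQ; by split.
- by apply: strict; split=> // q /hull_box/gb.
- have Ez'0 : sigma z' <> Open [::] by rewrite Ez'.
  have [+ _ _] := gammaP z' Ez'0; rewrite /allowed Ez' => /= gz'.
  have [g0 gq] := vertexP z' z'v Ez'0; rewrite gz' in g0 gq.
  by apply: strict; split=> // q /gq/lt_le_trans; apply.
Qed.

Lemma hull_instance : (feasible (hull Q) -> forall w, block s c w -> Q w) ->
  instances R rho (hull Q).
Proof.
move=> Qblock; split; [exact: hull_closed|exact: hull_convex| |].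
  move=> z /hull_box[z1 z2]; split=> [i|//].
  have R1 : 1 <= R by apply: R_ge1; apply: leq_ltn_trans (ltn_ord i).
  by have := z1 i; lra.
move=> /Qblock{}Qblock; exists (vertex s, c).
  by move=> i; rewrite mxE; case: (s i).
move=> y yc; apply/sub_hull/Qblock; split=> //= j.
apply: le_trans yc; rewrite [leRHS]/Num.norm /= mx_normrE.
by apply/bigmax_geP; right; exists (0, j); rewrite //= !mxE.
Qed.

End Instance.

Lemma members_infeasible : ~ feasible (hull (member sigma)).
Proof.
move=> [w [mw wint]].
have memQ q : member sigma q -> member sigma q \/ block s c q by left.
have [w01 _] := hull_box memQ mw.
have [t wt] := int_vertex w01 wint; have [D HD] := cons_finite cons.
pose g : space := (outward (vertex t), 0).
have gE q : inner g q = dot (outward (vertex t)) q.1 by rewrite innerE dot0l addr0.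
suff : inner g w < inner g w by rewrite ltxx.
have [||b [bt _ bD]] :=
  @strict_bound _ _ D (member sigma) (inner g) (inner g w) (inner g w - 1) _ _.
- by rewrite ltrBlDr ltrDl.
- by move=> q _ mq; rewrite !gE wt; apply: member_vertex cons mq.
by apply: hull_lt bt mw => q mq; apply: bD => //; apply: HD; case: mq => _ ->.
Qed.

End Endgame.

Lemma vertex_int s i : vertex (K := K) s 0 i \is a Num.int.
Proof. by rewrite mxE; case: (s i). Qed.

(** The feasible instance is the hull of the accepted points and of the cube of the
    surviving fiber; without the cube, the hull contains no vertex at all, because
    [outward] separates each vertex from the finitely many accepted points. *)
Theorem consistent_instances N sigma cnt : consistent N sigma cnt ->
  exists C1 C2 : set space, [/\ instances R rho C1, instances R rho C2,
    feasible C1, ~ feasible C2 &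
    exists gamma, forall z, sigma z <> Open [::] ->
      [/\ allowed sigma z (gamma z), valid C1 z (gamma z) & valid C2 z (gamma z)]].
Proof.
move=> cons; have [s [c [cR csep]]] := alive_cell cons.
have [gamma gammaP] : exists gamma, forall z, sigma z <> Open [::] ->
    separates_block s c sigma z (gamma z).
  have : forall z, exists g, sigma z <> Open [::] -> separates_block s c sigma z g.
    move=> z; have [Ez|Ez] := pselect (sigma z = Open [::]); first by exists 0.
    by have [g ?] := exists_normal cons cR csep Ez; exists g.
  by move=> /choice[gamma ?]; exists gamma.
pose Q1 : set space := member sigma `|` block s c.
have mQ1 w : member sigma w -> Q1 w by left.
have Q1m w : Q1 w -> member sigma w \/ block s c w by [].
have mQ2 w : member sigma w -> member sigma w \/ block s c w by left.
have infeasible := members_infeasible s cons cR.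
exists (hull Q1), (hull (member sigma)); split=> //.
- by apply: (hull_instance cons cR Q1m) => _ w; right.
- by apply: (hull_instance cons cR mQ2) => /infeasible.
- exists (vertex s, c); split; last by move=> i; apply: vertex_int.
  by apply: sub_hull; right; split=> //= j; rewrite subrr normr0 ltW.
- exists gamma => z Ez; split.
  + by have [] := gammaP z Ez.
  + exact: (hull_valid cons cR mQ1 Q1m gammaP Ez).
  + exact: (hull_valid cons cR _ mQ2 gammaP Ez).
Qed.

(** The first-order map follows the adversary on the two final instances, at the
    points asked about, and is given by [separation] elsewhere.  The queries may
    be any functions of one inner product with the normal, which covers both the
    sign and the value of that inner product. *)
Theorem query_lower_bound (A : Type) (Q : set (query K n d A)) (k : nat)
    (alg : algorithm K n d A) : (0 < d)%N ->
  (forall q, Q q -> exists v phi, forall g, q g = phi (inner v g)) ->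
  survives R rho M (fun _ : 'rV[K]_d => Open [::]) ->
  solves_within (instances R rho) Q k alg -> (2 ^ n * M <= k)%N.
Proof.
move=> d_gt0 Q_inner surv [perm solves].
have [N' [sigma [cnt [cons _ outcome]]]] := play Q_inner perm (consistent_start surv).
have [C1 [C2 [I1 I2 feas infeas [gamma gammaP]]]] := consistent_instances cons.
have default C z : exists g, instances R rho C -> valid C z g.
  have [IC|] := pselect (instances R rho C); last by exists 0.
  have [Cz|Cz] := pselect (C z); first by exists 0.
  have [Ccl Ccv Cb _] := IC; have [g g0 gC] := separation d_gt0 Ccl Ccv Cb Cz.
  by exists g.
have [G GP] : exists G : set space -> space -> space, forall C z,
    (instances R rho C -> valid C z (G C z)) /\
    (C = C1 \/ C = C2 -> allowed sigma z (G C z)).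
  suff H : forall p : set space * space, exists g,
      (instances R rho p.1 -> valid p.1 p.2 g) /\
      (p.1 = C1 \/ p.1 = C2 -> allowed sigma p.2 g).
    have [f fP] := choice H; exists (fun C z => f (C, z)) => C z; exact: (fP (C, z)).
  move=> [C z] /=; have [Ez|Ez] := pselect (sigma z = Open [::]).
    by have [g ?] := default C z; exists g; split=> // _; rewrite /allowed Ez.
  have [gz v1 v2] := gammaP z Ez.
  have [[->|->]|nC] := pselect (C = C1 \/ C = C2); [by exists (gamma z)..|].
  by have [g ?] := default C z; exists g.
have G_fo : first_order_map (instances R rho) G by move=> C IC z; apply: (GP C z).1.
have A1 w : allowed sigma w (G C1 w) by apply: (GP C1 w).2; left.
have A2 w : allowed sigma w (G C2 w) by apply: (GP C2 w).2; right.
have [r1 q1] := solves G G_fo C1 I1; have [r2 _] := solves G G_fo C2 I2.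
case: outcome => [[r rE]|H]; last exact: leq_trans (H _ A1) q1.
move: r1 r2; rewrite !rE //; case: r {rE} => [z|] /= r1 r2.
  by case: infeas; exists z.
by case: r1.
Qed.

End MixedGame.

(** * The rate *)

Lemma round_length_ge d : (2 <= d)%N -> (d ^ 2 <= 64 * round_length d ^ 2)%N.
Proof.
move=> d2; have d8k : (d <= 8 * round_length d)%N by rewrite /round_length; lia.
by rewrite (_ : 64 = 8 ^ 2)%N // -expnMn leq_exp2r.
Qed.

Section Rate.
Context {K : realType} (d : nat) (R rho : K).
Hypotheses (R_gt0 : 0 < R) (rho_gt0 : 0 < rho) (d_ge2 : (2 <= d)%N)
  (rhoR : rho < R / (6 * d%:R)).

(** As [x = ln (R / rho) / ln (6 * d)] is greater than 1, its integral part [t] is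
    at least [x / 2]; and [6 * d <= d ^ 4], so that [ln (6 * d) <= 4 * ln d] and
    [ln (R / rho) / ln d <= 8 * t]. *)
Lemma number_of_rounds : exists t : nat, [/\ (0 < t)%N,
  rho * (6 * d%:R) ^+ t <= R &
  1 + (ln d%:R)^-1 * ln (R / rho) <= 9 * t%:R].
Proof.
have dK : 2 <= d%:R :> K by rewrite ler_nat.
set b : K := 6 * d%:R; have b_gt1 : 1 < b by rewrite /b; lra.
have b_gt0 : 0 < b by lra.
have lnb_gt0 : 0 < ln b by apply: ln_gt0.
have lnd_gt0 : 0 < ln d%:R :> K by apply: ln_gt0; lra.
have Rrho_gt0 : 0 < R / rho by rewrite divr_gt0.
pose x := ln (R / rho) / ln b.
have x_ge1 : 1 <= x.
  rewrite ler_pdivlMr // mul1r ler_ln ?posrE // ler_pdivlMr // ltW //.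
  by rewrite mulrC -ltr_pdivlMr.
have x_ge0 : 0 <= x by lra.
have /andP[tx xt] := truncn_itv x_ge0; set t := Num.truncn x in tx xt.
have t_gt0 : (0 < t)%N by rewrite truncn_gt0.
exists t; split=> //.
  rewrite mulrC -ler_pdivlMr // -ler_ln ?posrE ?exprn_gt0 // lnXn //.
  by rewrite -mulr_natl -ler_pdivlMr.
have lnb_le : ln b <= 4 * ln d%:R.
  rewrite mulr_natl -lnXn; last by lra.
  rewrite ler_ln ?posrE ?exprn_gt0 //; last by lra.
  rewrite /b -natrM -natrX ler_nat expnSr leq_mul2r.
  by rewrite (@leq_trans (2 ^ 3)) ?orbT // leq_exp2r.
have tK : 1 <= t%:R :> K by rewrite ler1n.
have lnR_le : ln (R / rho) <= 8 * t%:R * ln d%:R.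
  have : ln (R / rho) <= t.+1%:R * ln b by rewrite -ler_pdivrMr // ltW.
  have : t.+1%:R <= 2 * t%:R :> K by rewrite -natr1; lra.
  by move=> /(ler_wpM2r (ltW lnb_gt0)); nra.
have : (ln d%:R)^-1 * ln (R / rho) <= 8 * t%:R by rewrite mulrC ler_pdivrMr.
lra.
Qed.

(** The constant is [576 = 64 * 9], from [d ^ 2 <= 64 * round_length d ^ 2] and
    [number_of_rounds]. *)
Lemma icomp_lower_bound n (A : Type) (Q : set (query K n d A)) :
  ((0 < n)%N -> 1 <= R) ->
  (forall q, Q q -> exists v phi, forall g, q g = phi (inner v g)) ->
  ((576^-1 * (2 ^+ n * d%:R ^+ 2 * (1 + (ln d%:R)^-1 * ln (R / rho))))%:E
    <= icomp (instances R rho) Q)%E.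
Proof.
move=> R_ge1 Q_inner; have [t [t_gt0 tR t_rate]] := number_of_rounds.
have surv := survives_all_rounds d_ge2 R_gt0 rho_gt0 tR t_gt0.
apply/le_ereal_inf_tmp => _ [k [alg solves] <-]; rewrite lee_fin.
have : (2 ^ n * (t * round_length d ^ 2) <= k)%N.
  by apply: query_lower_bound solves => //; exact: ltnW.
rewrite -(ler_nat K) !natrM natrX; apply: le_trans.
have := round_length_ge d_ge2; rewrite -(ler_nat K) natrM !natrX => dk.
rewrite -mulrA mulrCA ler_wpM2l ?exprn_ge0 //.
apply: (@le_trans _ _ (576^-1 * (64 * (round_length d)%:R ^+ 2 * (9 * t%:R)))).
  apply: ler_wpM2l; first by rewrite invr_ge0 ler0n.
  apply: ler_pM; rewrite ?exprn_ge0 // addr_ge0 // mulr_ge0 //.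
    by rewrite invr_ge0 ln_ge0 // ler1n ltnW.
  rewrite ln_ge0 // ler_pdivlMr // mul1r; apply/ltW/(lt_le_trans rhoR).
  rewrite ler_pdivrMr; last by rewrite mulr_gt0 // ltr0n ltnW.
  rewrite ler_peMr ?ltW //; have : 2 <= d%:R :> K by rewrite ler_nat.
  lra.
by lra.
Qed.

End Rate.

Theorem theorem4 (K : realType) :
  exists2 c : K, 0 < c &
    forall (n d : nat) (R rho : K),
      0 < R -> 0 < rho -> ((0 < n)%N -> 1 <= R) ->
      (2 <= d)%N -> rho < R / (6 * d%:R) ->
      ((c * (2 ^+ n * d%:R ^+ 2 * (1 + (ln d%:R)^-1 * ln (R / rho))))%:E
         <= icomp (@instances K n d R rho) (@Qdir K n d))%E /\
      ((c * (2 ^+ n * d%:R ^+ 2 * (1 + (ln d%:R)^-1 * ln (R / rho))))%:E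
         <= icomp (@instances K n d R rho) (@Qip K n d))%E.
Proof.
exists 576^-1; first by rewrite invr_gt0 ltr0n.
move=> n d R rho R_gt0 rho_gt0 R_ge1 d_ge2 rhoR.
split; apply: icomp_lower_bound => // q [v ->].
  by exists v, (fun a => 0 < a).
by exists v, id.
Qed.
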